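(* Let $\mathcal U$ be a full rank, primitive upper cluster algebra with coefficient semifield $\mathbb P={\rm Trop}(Z_1,\ldots,Z_m)$, and let $t, t_0$ be two seeds of $\mathcal U$ with no common cluster variables. Then $\mathcal U=\mathcal L(t)\cap\mathcal L(t_0)$, where $\mathcal L(t)=\mathbb {KP}[A_{1;t}^{\pm1},\ldots,A_{n;t}^{\pm1}]$ and $\mathcal L(t_0)=\mathbb {KP}[A_{1;t_0}^{\pm1},\ldots,A_{n;t_0}^{\pm1}]$.
   Context: Throughout, $\mathbb K$ is a factorial domain (UFD) of characteristic $0$. A semifield $(\mathbb P,\oplus,\cdot)$ is an abelian multiplicative group with a commutative, associative operation $\oplus$ over which multiplication distributes; $\mathbb{KP}$ is its group ring over $\mathbb K$, and $\mathcal F$ is the field of rational functions in $n$ independent variables with coefficients in $\mathbb{KP}$. An integer $n\times n$ matrix $B$ is skew-symmetrizable if $SB$ is skew-symmetric for some integer diagonal matrix $S$ with positive diagonal entries. A (labeled) $\mathscr A$-seed over $\mathbb P$ is a triple $(B,X,A)$ with $B=(b_{ij})$ an $n\times n$ skew-symmetrizable integer matrix, $X=(X_1,\ldots,X_n)\in\mathbb P^n$, and $A=(A_1,\ldots,A_n)$ a free generating set of $\mathcal F$ over $\mathbb{KP}$. Its $k$-th exchange binomial is $P_k=\frac{X_k}{1\oplus X_k}\prod_{b_{jk}>0}A_j^{b_{jk}}+\frac{1}{1\oplus X_k}\prod_{b_{jk}<0}A_j^{-b_{jk}}$. The mutation $\mu_k(B,X,A)=(B',X',A')$ is: $b'_{ij}=-b_{ij}$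 if $i=k$ or $j=k$, else $b'_{ij}=b_{ij}+\mathrm{sgn}(b_{ik})\max(b_{ik}b_{kj},0)$; $X'_k=X_k^{-1}$ and $X'_i=X_iX_k^{\max(b_{ki},0)}(1\oplus X_k)^{-b_{ki}}$ for $i\ne k$; $A'_i=A_i$ for $i\neq k$ and $A'_k=A_k^{-1}P_k$. Let $\mathbb T_n$ be the $n$-regular tree with edges labeled $1,\ldots,n$ so that edges at each vertex have distinct labels. An $\mathscr A$-seed pattern assigns to each vertex $t$ a seed $(B_t,X_t,A_t)$, $B_t=(b^t_{ij})$, $X_t=(X_{1;t},\ldots,X_{n;t})$, $A_t=(A_{1;t},\ldots,A_{n;t})$, such that seeds at vertices joined by an edge labeled $k$ are related by $\mu_k$. A vertex and its seed are denoted by the same letter. The upper cluster algebra is $\mathcal U=\bigcap_{t\in\mathbb T_n}\mathcal L(t)$ with $\mathcal L(t)=\mathbb{KP}[A_{1;t}^{\pm1},\ldots,A_{n;t}^{\pm1}]$. The $A_{k;t}$ are the cluster variables. Standing assumption: no exchange binomial of $\mathcal U$ is invertible in $\mathbb{KP}$. Geometric type: $\mathbb P=\mathrm{Trop}(Z_1,\ldots,Z_m)$, the free abelian group on $Z_1,\ldots,Z_m$ with $\prod Z_i^{a_i}\oplus\prod Z_i^{b_i}=\prod Z_i^{\min(a_i,b_i)}$. Writing $X_{k;t}=\prod_i Z_i^{c_{ik}^t}$, $C_t=(c_{ij}^t)_{m\times n}$, the extended exchange matrix is the $(n+m)\times n$ matrix $\widetilde B_t=\begin{pmatrix}B_t\\C_t\end{pmatrix}$.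 $\mathcal U$ is full rank if it is of geometric type and $\widetilde B_{t}$ has full rank $n$ for one (equivalently every) seed $t$; it is primitive if it is of geometric type and, for one (equivalently every) seed $t$, each column of $\widetilde B_{t}$ is primitive (the gcd of its entries is $1$). *)

(* Defs.v *)
From mathcomp Require Import all_boot all_order all_algebra.
From mathcomp Require Import fraction.
From mathcomp Require Import mpoly.

Set Implicit Arguments.
Unset Strict Implicit.
Unset Printing Implicit Defensive.

Import Order.TTheory GRing.Theory Num.Theory.
Local Open Scope ring_scope.

Section Factorial.
Variable K : idomainType.

Definition irreducible_elt (x : K) : Prop :=
  [/\ x != 0, x \isn't a GRing.unit
    & forall a b : K, x = a * b -> a \is a GRing.unit \/ b \is a GRing.unit].

Definition associated (x y : K) : Prop :=
  exists2 u : K, u \is a GRing.unit & y = u * x.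

Definition factorial_domain : Prop :=
  (forall x : K, x != 0 -> x \isn't a GRing.unit ->
     exists2 s : seq K, {in s, forall p, irreducible_elt p}
                      & x = \prod_(p <- s) p)
  /\
  (forall s1 s2 : seq K,
     {in s1, forall p, irreducible_elt p} ->
     {in s2, forall p, irreducible_elt p} ->
     \prod_(p <- s1) p = \prod_(p <- s2) p ->
     exists s3 : seq K,
       [/\ perm_eq s2 s3, size s1 = size s3
         & forall i, (i < size s1)%N -> associated s1`_i s3`_i]).

End Factorial.

(* [laurent R x] is the set R[x_1^{+-1}, ..., x_p^{+-1}] inside F, for a     *)
(* subset R of F.                                                            *)
Definition laurent (F : fieldType) (p : nat) (R : F -> Prop) (x : 'I_p -> F)
    (f : F) : Prop :=
  exists (s : seq 'rV[int]_p) (c : 'rV[int]_p -> F),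
    (forall e, R (c e)) /\ f = \sum_(e <- s) c e * \prod_(i < p) x i ^ e 0 i.

(* The monomial Z^a of Trop(Z_1, ..., Z_m) is represented by its exponent    *)
(* vector a.  The group law of Trop is thus the addition of vectors, the     *)
(* unit of the group is 0, and the z-th power of a is a *~ z.                *)
Definition trop (m : nat) : zmodType := 'cV[int]_m.

Definition trop_oplus (m : nat) (a b : trop m) : trop m :=
  \col_(i < m) Num.min ((a : 'cV[int]_m) i 0) ((b : 'cV[int]_m) i 0).

(* The n-regular tree, as the Cayley graph of the free product of n copies   *)
(* of Z/2: vertices are the words without two equal consecutive letters, and *)
(* an edge labeled k joins w and k :: w whenever both are such words.        *)
Definition tree (n : nat) : Type :=
  {w : seq 'I_n | sorted (fun i j => i != j) w}.

Definition tree_edge (n : nat) (k : 'I_n) (s t : tree n) : Prop :=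
  sval t = k :: sval s \/ sval s = k :: sval t.

Definition skew_symmetrizable (n : nat) (B : 'M[int]_n) : Prop :=
  exists2 d : 'rV[int]_n, forall i, 0 < d 0 i
    & (diag_mx d *m B)^T = - (diag_mx d *m B).

Section Cluster.
Variables (K : idomainType) (m n : nat).

(* The field of fractions of KP, P = Trop(Z_1, ..., Z_m): since KP is the    *)
(* Laurent polynomial ring K[Z_1^{+-1}, ..., Z_m^{+-1}], this is K(Z).  KP   *)
(* itself is the subset [KP] of F below.                                     *)
Definition coef_field : fieldType := {fraction {mpoly K[m]}}.

(* The field F of rational functions in n variables over KP.                 *)
Definition rat_field : fieldType := {fraction {mpoly coef_field[n]}}.

Definition coef_inj (c : coef_field) : rat_field :=
  tofrac (mpolyC n c : {mpoly coef_field[n]}).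

Definition Kinj (a : K) : rat_field :=
  coef_inj (tofrac (mpolyC m a : {mpoly K[m]})).

Definition Zvar (i : 'I_m) : rat_field :=
  coef_inj (tofrac ('X_i : {mpoly K[m]})).

Definition trop_inj (a : trop m) : rat_field :=
  \prod_(i < m) Zvar i ^ (a : 'cV[int]_m) i 0.

Definition KP : rat_field -> Prop :=
  laurent (fun f => exists a : K, f = Kinj a) Zvar.

Definition KP_invertible (f : rat_field) : Prop :=
  KP f /\ exists2 g, KP g & f * g = 1.

Definition free_generating (A : 'I_n -> rat_field) : Prop :=
  (forall p : {mpoly rat_field[n]},
     (forall e, KP p@_e) -> p.@[A] = 0 -> p = 0)
  /\
  (forall f : rat_field, exists p q : {mpoly rat_field[n]},
     [/\ forall e, KP p@_e, forall e, KP q@_e, q.@[A] != 0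
       & f = p.@[A] / q.@[A]]).

Record seed_data := SeedData {
  exB : 'M[int]_n;
  exX : {ffun 'I_n -> trop m};
  exA : {ffun 'I_n -> rat_field} }.

Definition is_seed (S : seed_data) : Prop :=
  skew_symmetrizable (exB S) /\ free_generating (exA S).

(* The two coefficients are X_k / (1 (+) X_k) and 1 / (1 (+) X_k), written   *)
(* additively in Trop as explained at [trop].                                *)
Definition exchange_binomial (S : seed_data) (k : 'I_n) : rat_field :=
  let: SeedData B X A := S in
  trop_inj (X k - trop_oplus 0 (X k))
    * \prod_(j < n | 0 < B j k) A j ^ B j k
  + trop_inj (- trop_oplus 0 (X k))
    * \prod_(j < n | B j k < 0) A j ^ (- B j k).

Definition mutation (k : 'I_n) (S : seed_data) : seed_data :=
  let: SeedData B X A := S in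
  SeedData
    (\matrix_(i, j)
       if (i == k) || (j == k) then - B i j
       else B i j + Num.sg (B i k) * Num.max (B i k * B k j) 0)
    [ffun i => if i == k then - X k
               else X i + X k *~ Num.max (B k i) 0
                    + trop_oplus 0 (X k) *~ (- B k i)]
    [ffun i => if i == k then (A k)^-1 * exchange_binomial S k else A i].

Definition seed_pattern (S : tree n -> seed_data) : Prop :=
  (forall t, is_seed (S t)) /\
  (forall k s t, tree_edge k s t -> S t = mutation k (S s)).

Definition laurent_ring (S : seed_data) : rat_field -> Prop :=
  laurent KP (exA S).

Definition upper_cluster_algebra (S : tree n -> seed_data) (f : rat_field) : Prop :=
  forall t, laurent_ring (S t) f.

Definition extended_matrix (S : seed_data) : 'M[int]_(n + m, n) :=
  col_mx (exB S) (\matrix_(i < m, j < n) (exX S j : 'cV[int]_m) i 0).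

Definition full_rank (S : tree n -> seed_data) : Prop :=
  exists t, \rank (map_mx (fun z : int => z%:~R : rat) (extended_matrix (S t)))
            = n.

Definition primitive (S : tree n -> seed_data) : Prop :=
  exists t, forall j : 'I_n,
    \big[gcdz/0]_(i < n + m) extended_matrix (S t) i j = 1.

Definition no_invertible_binomial (S : tree n -> seed_data) : Prop :=
  forall t k, ~ KP_invertible (exchange_binomial (S t) k).

Definition no_common_cluster_variables (S1 S2 : seed_data) : Prop :=
  forall i j : 'I_n, exA S1 i <> exA S2 j.

End Cluster.

(* Main.v *)
(* Write A_t for the extended cluster at t, u_k for the k-th column of the   *)
(* extended exchange matrix, and P_k for the exchange binomial, which is a   *)
(* unit times 1 + A_t^(u_k). Primitivity provides an integral linear form    *)
(* equal to 1 on u_k, so that the Laurent ring is S[x, 1/x] with x =         *)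
(* A_t^(u_k), and evaluation at x = -1 shows that P_k is prime. The          *)
(* intersection of L(t) with its neighbours L(mu_k t) is then the same for   *)
(* all t (for b_jk <> 0 because A_j and A_k are comaximal, and for b_jk = 0  *)
(* because P_j and P_k are coprime, by full rank), hence equals U, and A_k   *)
(* is prime in U because A_k divides x in U iff P_k divides x in L(mu_k t).  *)
(* If f lies in L(t) and L(t0), then f A_t^d and f A_(t0)^e are in U, and f  *)
(* is in U as soon as no A_(k;t) divides any A_(i;t0). Such a divisibility   *)
(* would make A_(k;t) / A_(i;t0) a unit of U, that is a coefficient times a  *)
(* frozen monomial; the Laurent phenomenon over Z forces the coefficient to  *)
(* be 1 or -1, and subtraction-freeness (tropical evaluation) makes the unit *)
(* equal to 1.                                                               *)
Require Import Defs.
From mathcomp Require Import all_boot all_order all_algebra.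
From mathcomp Require Import fraction mpoly.
From mathcomp Require Import ring zify.
Set Implicit Arguments.
Unset Strict Implicit.
Unset Printing Implicit Defensive.
Import Order.TTheory GRing.Theory Num.Theory.
Local Open Scope ring_scope.

(** * Laurent extensions in one variable *)

Record subring (F : fieldType) (S : F -> Prop) : Prop := Subring {
  subring1 : S 1;
  subringB : forall a b, S a -> S b -> S (a - b);
  subringM : forall a b, S a -> S b -> S (a * b) }.

Section Subring.
Variables (F : fieldType) (S : F -> Prop).
Hypothesis subS : subring S.

Lemma subring0 : S 0.
Proof. by rewrite -(subrr 1); apply: subringB => //; apply: subring1. Qed.

Lemma subringN a : S a -> S (- a).
Proof. by move=> Sa; rewrite -[- a]add0r; apply: subringB => //; apply: subring0. Qed.

Lemma subringD a b : S a -> S b -> S (a + b).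
Proof. by move=> Sa Sb; rewrite -[b]opprK; apply: subringB => //; apply: subringN. Qed.

Lemma subringX a i : S a -> S (a ^+ i).
Proof.
move=> Sa; elim: i => [|i IHi]; first by rewrite expr0; apply: subring1.
by rewrite exprS; apply: subringM.
Qed.

Lemma subring_sum (I : Type) (r : seq I) (P : pred I) (E : I -> F) :
  (forall i, P i -> S (E i)) -> S (\sum_(i <- r | P i) E i).
Proof. by move=> SE; elim/big_ind: _ => //; [apply: subring0 | apply: subringD]. Qed.

Lemma subring_prod (I : Type) (r : seq I) (P : pred I) (E : I -> F) :
  (forall i, P i -> S (E i)) -> S (\prod_(i <- r | P i) E i).
Proof. by move=> SE; elim/big_ind: _ => //; [apply: subring1 | apply: subringM]. Qed.

Lemma subringMn a i : S a -> S (a *+ i).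
Proof. by move=> Sa; rewrite -[i]card_ord -sumr_const; apply: subring_sum. Qed.

Lemma subring_exprz a z : S a -> S a^-1 -> S (a ^ z).
Proof.
by move=> Sa SaV; case: z => i; rewrite ?NegzE -?exprz_inv; apply: subringX.
Qed.

Definition polyS (p : {poly F}) := forall i, S p`_i.

Lemma polySC a : S a -> polyS a%:P.
Proof. by move=> Sa i; rewrite coefC; case: ifP => // _; apply: subring0. Qed.

Lemma polySXn i : polyS 'X^i.
Proof. by move=> j; rewrite coefXn; apply: subringMn; apply: subring1. Qed.

Lemma polySM p q : polyS p -> polyS q -> polyS (p * q).
Proof.
move=> Sp Sq i; rewrite coefM; apply: subring_sum => j _.
by apply: subringM.
Qed.

Lemma polySB p q : polyS p -> polyS q -> polyS (p - q).
Proof. by move=> Sp Sq i; rewrite coefB; apply: subringB. Qed.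

End Subring.

Lemma subring_horner (F : fieldType) (S T : F -> Prop) p x :
  subring T -> (forall a, S a -> T a) -> polyS S p -> T x -> T p.[x].
Proof.
move=> subT ST Sp Tx; rewrite horner_coef.
elim/big_ind: _ => [||i _]; first exact: subring0.
  exact: subringD.
by apply: (subringM subT); [apply: ST | apply: subringX].
Qed.

(** The ring S[x, 1/x], with a single power of x as denominator, so that one polynomial describes an
    element. *)
Definition lau (F : fieldType) (S : F -> Prop) (x f : F) : Prop :=
  exists s p, polyS S p /\ f * x ^+ s = p.[x].

Definition transc (F : fieldType) (S : F -> Prop) (x : F) : Prop :=
  forall p, polyS S p -> p.[x] = 0 -> p = 0.

Section Laurent.
Variables (F : fieldType) (S : F -> Prop) (x : F).
Hypotheses (subS : subring S) (x0 : x != 0).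

Lemma lau_const a : S a -> lau S x a.
Proof.
by move=> Sa; exists 0%N, a%:P; split; [exact: polySC | rewrite hornerC mulr1].
Qed.

Lemma lau_var : lau S x x.
Proof.
by exists 0%N, 'X^1; split; [exact: polySXn | rewrite hornerXn mulr1].
Qed.

Lemma lau_varV : lau S x x^-1.
Proof.
exists 1%N, 'X^0; split; first exact: polySXn.
by rewrite hornerXn expr0 expr1 mulVf.
Qed.

Lemma lau_subring : subring (lau S x).
Proof.
split=> [|a b|a b]; first by apply: lau_const; apply: subring1.
  move=> [s [p [Sp ap]]] [r [q [Sq bq]]].
  exists (s + r)%N, (p * 'X^r - q * 'X^s); split.
    by apply: polySB => //; apply: polySM => //; apply: polySXn.
  by rewrite hornerD hornerN !hornerM !hornerXn -ap -bq exprD; ring.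
move=> [s [p [Sp ap]]] [r [q [Sq bq]]].
exists (s + r)%N, (p * q); split; first exact: polySM.
by rewrite hornerM -ap -bq exprD; ring.
Qed.

Lemma lau_min (T : F -> Prop) f :
  subring T -> (forall a, S a -> T a) -> T x -> T x^-1 -> lau S x f -> T f.
Proof.
move=> subT ST Tx TxV [s [p [Sp fp]]].
have -> : f = p.[x] * x^-1 ^+ s by rewrite -fp exprVn mulfK ?expf_neq0.
apply: (subringM subT); first exact: (subring_horner subT ST).
exact: subringX.
Qed.

Hypothesis trx : transc S x.

Lemma transc_inj p q : polyS S p -> polyS S q -> p.[x] = q.[x] -> p = q.
Proof.
move=> Sp Sq pq; apply/eqP; rewrite -subr_eq0; apply/eqP; apply: trx.
  exact: polySB.
by rewrite hornerD hornerN pq subrr.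
Qed.

(** X + 1 is monic, so the coefficients of the quotient are obtained from the top down within S. *)
Lemma polyS_div_Xadd1 p q : polyS S p -> p = q * ('X + 1) -> polyS S q.
Proof.
move=> Sp pq.
have step i : q`_i = p`_i.+1 - q`_i.+1.
  by rewrite pq mulrDr mulr1 coefD coefMX /= addrK.
move=> i; have [k] := ubnP (size q - i)%N; elim: k i => // k IHk i lek.
have [lei|ltq] := leqP (size q) i; first by rewrite nth_default //; apply: subring0.
by rewrite step; apply: (subringB subS) => //; apply: IHk; lia.
Qed.

Lemma root_polyS (p : {poly F}) : root p (-1) -> exists q, p = q * ('X + 1).
Proof. by case/factor_theorem=> q ->; exists q; rewrite polyCN opprK. Qed.

Lemma onex_neq0 : 1 + x != 0.
Proof.
apply/eqP=> x1.
have : 'X + 1 = 0 :> {poly F}.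
  apply: trx.
    rewrite -['X]expr1 -[1]opprK; apply: polySB => //; first exact: polySXn.
    rewrite -polyCN; apply: polySC => //; apply: subringN => //.
    exact: subring1.
  by rewrite hornerD hornerX hornerC addrC.
by move/eqP; rewrite -size_poly_eq0 size_XaddC.
Qed.

(* Modulo 1 + x the Laurent ring becomes S, by evaluation at x = -1. *)
Lemma lau_dvd_onex f s p : polyS S p -> f * x ^+ s = p.[x] ->
  lau S x (f / (1 + x)) <-> p.[-1] = 0.
Proof.
move=> Sp fp; split=> [[r [q [Sq fq]]]|p1].
  have E : p * 'X^r = q * 'X^s * ('X + 1).
    apply: transc_inj.
    - by apply: polySM => //; apply: polySXn.
    - apply: polySM => //; first by apply: polySM => //; apply: polySXn.
      rewrite -['X]expr1 -[1]opprK; apply: polySB => //; first exact: polySXn.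
      rewrite -polyCN; apply: polySC => //; apply: subringN => //.
      exact: subring1.
    rewrite !hornerM !hornerXn hornerD hornerX hornerC -fp -fq.
    by have := onex_neq0 => h; field.
  move/(congr1 (fun h => h.[-1])): E.
  rewrite !hornerM !hornerXn hornerD hornerX hornerC addNr mulr0.
  by move/eqP; rewrite mulf_eq0 expf_eq0 oppr_eq0 oner_eq0 andbF orbF => /eqP.
have [|q pq] := @root_polyS p; first by rewrite /root p1.
exists s, q; split; first exact: polyS_div_Xadd1 pq.
rewrite mulrAC fp pq hornerM hornerD hornerX hornerC [x + 1]addrC.
by rewrite mulfK // onex_neq0.
Qed.

(** Evaluation at -1 takes values in a field, where a product vanishes only if a factor does. *)
Lemma lau_prime_onex f g : lau S x f -> lau S x g ->
  lau S x (f * g / (1 + x)) -> lau S x (f / (1 + x)) \/ lau S x (g / (1 + x)).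
Proof.
move=> [s [p [Sp fp]]] [r [q [Sq gq]]].
rewrite (lau_dvd_onex (s := (s + r)%N) (p := p * q)); last 2 first.
- exact: polySM.
- by rewrite hornerM -fp -gq exprD; ring.
rewrite (lau_dvd_onex Sp fp) (lau_dvd_onex Sq gq) hornerM => /eqP.
by rewrite mulf_eq0 => /orP[] /eqP ->; [left | right].
Qed.

Lemma polyXn_factor (p q : {poly F}) N : p * q = 'X^N ->
  exists i, p = p`_i *: 'X^i.
Proof.
move=> pq; have : p %| ('X - 0%:P) ^+ N by rewrite subr0 -pq dvdp_mulr.
move=> /dvdp_exp_XsubCP [k _]; rewrite subr0 => /eqpP [[a b] /= /andP[a0 b0] E].
exists k; have -> : p = (b / a) *: 'X^k.
  by rewrite mulrC -scalerA -E scalerA mulVf ?scale1r.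
by rewrite coefZ coefXn eqxx mulr1.
Qed.

(** Cleared of denominators, c and its inverse have a power of X as product, so both are monomials;
    the value at 1 shows that their coefficients are inverse to each other. *)
Lemma lau_unit c : c != 0 -> lau S x c -> lau S x c^-1 ->
  exists a (z : int), [/\ S a, S a^-1 & c = a * x ^ z].
Proof.
move=> c0 [s [p [Sp cp]]] [r [q [Sq cq]]].
have pq : p * q = 'X^(s + r).
  apply: transc_inj; [exact: polySM | exact: polySXn|].
  rewrite hornerM -cp -cq hornerXn exprD mulrACA mulfV // mul1r //.
have [i pi] := polyXn_factor pq.
have [j qj] : exists j, q = q`_j *: 'X^j.
  by apply: (polyXn_factor (q := p)); rewrite mulrC; exact: pq.
have pa0 : p`_i * q`_j = 1.
  have: (p * q).[1] = 1 by rewrite pq hornerXn expr1n.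
  by rewrite pi qj hornerM !hornerZ !hornerXn !expr1n !mulr1 !coefZ !coefXn !eqxx !mulr1.
exists p`_i, (Posz i - Posz s); split => //.
  suff -> : (p`_i)^-1 = q`_j by [].
  rewrite -[_^-1]mulr1 -pa0 mulrA mulVf ?mul1r //.
  by apply/eqP=> p0; move/eqP: pa0; rewrite p0 mul0r eq_sym oner_eq0.
have xs0 : x ^+ s != 0 by rewrite expf_neq0.
apply: (mulIf xs0); rewrite cp {1}pi hornerZ hornerXn -mulrA; congr (_ * _).
by rewrite (exprnP x s) (exprnP x i) -expfzDr // subrK.
Qed.

Section Exchange.
Variables (y P : F).
Hypotheses (y0 : y != 0) (xyP : x * y = P) (SP : S P).

(** Substituting y = P / x in an expansion of f in powers of y attaches a factor P^d to each x^-d;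
    by transcendence this is the expansion of f in x. *)
Lemma exch_coef_dvd f s p : polyS S p -> f * x ^+ s = p.[x] -> lau S y f ->
  forall i, (i < s)%N -> exists2 g, S g & p`_i = P ^+ (s - i) * g.
Proof.
move=> Sp fp [r [q [Sq fq]]] i ltis.
have P0 : P != 0 by rewrite -xyP mulf_neq0.
set M := size q.
(* h(x) = x^M q(P / x): the coefficients of q reversed and weighted by powers of P. *)
pose h := \poly_(j < M.+1) (q`_(M - j) * P ^+ (M - j)).
have Sh : polyS S h.
  move=> j; rewrite coef_poly; case: ifP => _; last exact: subring0.
  by apply: (subringM subS) => //; apply: subringX.
have hq : q.[y] * x ^+ M = h.[x].
  rewrite (@horner_coef_wide _ M.+1) // horner_poly mulr_suml.
  rewrite (reindex_inj rev_ord_inj) /=; apply: eq_bigr => j _.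
  have lej : (j <= M)%N by rewrite -ltnS.
  rewrite subSS.
  have -> : x ^+ M = x ^+ (M - j) * x ^+ j by rewrite -exprD subnK.
  by rewrite -xyP exprMn; ring.
have E : (P ^+ r)%:P * p * 'X^M = 'X^(r + s) * h.
  apply: transc_inj.
  - apply: polySM => //; last exact: polySXn.
    by apply: polySM => //; apply: polySC => //; apply: subringX.
  - by apply: polySM => //; apply: polySXn.
  rewrite !hornerM !hornerXn hornerC -fp -hq -fq -xyP exprMn exprD; ring.
move/(congr1 (fun a : {poly F} => a`_(M + i))): E.
rewrite coefMXn ltnNge leq_addr /= addKn coefCM coefXnM coef_poly => E.
exists q`_(r + s - i) => //.
apply: (mulfI (expf_neq0 r P0)); rewrite mulrA -exprD addnBA; last exact: ltnW.
(* If M + i < r + s, the coefficient of h is 0, and so is that of q, whose index exceeds the size of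
   q. *)
rewrite E; case: ltnP => h1.
  rewrite [in RHS]nth_default ?mulr0 // -/M.
  by move: (M) h1 => M' h1; lia.
rewrite ifT; last by lia.
by rewrite mulrC; have -> : (M - (M + i - (r + s)) = r + s - i)%N by lia.
Qed.

(** A term P^d g x^-d equals g y^d, so negative powers of x become positive powers of y. *)
Lemma exch_coef_mem (T : F -> Prop) f s p : subring T ->
  (forall a, S a -> T a) -> T x -> T y ->
  polyS S p -> f * x ^+ s = p.[x] ->
  (forall i, (i < s)%N -> exists2 g, S g & p`_i = P ^+ (s - i) * g) -> T f.
Proof.
move=> subT ST Tx Ty Sp fp dvd_p.
have xs0 : x ^+ s != 0 by rewrite expf_neq0.
have -> : f = \sum_(i < size p) p`_i * x ^+ i / x ^+ s.
  by rewrite -mulr_suml -horner_coef -fp mulfK.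
apply: subring_sum => // i _; have [ltis|lesi] := ltnP i s.
  have [g Sg ->] := dvd_p i ltis.
  rewrite -{2}(subnK (ltnW ltis)) exprD -xyP exprMn.
  have -> : x ^+ (s - i) * y ^+ (s - i) * g * x ^+ i / (x ^+ (s - i) * x ^+ i)
           = y ^+ (s - i) * g.
    by field; rewrite ?expf_neq0.
  by apply: (subringM subT); [apply: subringX | apply: ST].
rewrite -(subnK lesi) exprD mulrA mulfK //.
by apply: (subringM subT); [apply: ST | apply: subringX].
Qed.

(** S[x, 1/x] and S[y, 1/y] meet inside S[x, y]; [T] is any ring containing the latter. *)
Lemma lau_exch_mem (T : F -> Prop) f : subring T ->
  (forall a, S a -> T a) -> T x -> T y -> lau S x f -> lau S y f -> T f.
Proof.
move=> subT ST Tx Ty [s [p [Sp fp]]] fy.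
by apply: (exch_coef_mem subT ST Tx Ty Sp fp); apply: exch_coef_dvd Sp fp fy.
Qed.

End Exchange.
End Laurent.

Lemma exch_lau (F : fieldType) (S : F -> Prop) (x y P f : F) s p :
  subring S -> x != 0 -> y != 0 -> x * y = P -> S P ->
  polyS S p -> f * x ^+ s = p.[x] ->
  (forall i, (i < s)%N -> exists2 g, S g & p`_i = P ^+ (s - i) * g) -> lau S y f.
Proof.
move=> subS x0 y0 xyP SP Sp fp; have subL := lau_subring y subS.
apply: (exch_coef_mem x0 xyP subL) Sp fp => //; first exact: lau_const.
  have -> : x = P * y^-1 by rewrite -xyP mulfK.
  by apply: (subringM subL); [apply: lau_const | apply: lau_varV].
exact: lau_var.
Qed.

(* The divisibility hypothesis holds when P is prime in S and does not divide Q. *)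
Lemma lau_exch_coprime (F : fieldType) (S : F -> Prop) (x y P Q f : F) :
  subring S -> x != 0 -> transc S x -> y != 0 -> x * y = P -> S P -> S Q ->
  (forall a, S a -> S (Q * a / P) -> S (a / P)) ->
  lau S x f -> lau S y (Q * f) -> lau S y f.
Proof.
move=> subS x0 trx y0 xyP SP SQ coP [s [p [Sp fp]]] fy.
have P0 : P != 0 by rewrite -xyP mulf_neq0.
apply: (exch_lau subS x0 y0 xyP SP Sp fp) => i ltis.
have SQp : polyS S (Q%:P * p) by exact: (polySM subS (polySC subS SQ) Sp).
have QfE : Q * f * x ^+ s = (Q%:P * p).[x].
  by rewrite hornerM hornerC -fp mulrA.
have [g Sg] := exch_coef_dvd subS x0 trx y0 xyP SP SQp QfE fy ltis.
(* The power of P is extracted from the coefficient one factor at a time: P divides Q a, hence a. *)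
rewrite coefCM => E; elim: (s - i)%N (p`_i) (Sp i) g Sg E => [|k IHk] a Sa g Sg E.
  by exists a; rewrite ?expr0 ?mul1r.
have Sa' : S (a / P).
  apply: coP => //; rewrite E exprS.
  have -> : P * P ^+ k * g / P = P ^+ k * g by field.
  by apply: (subringM subS) => //; apply: subringX.
have [|g' Sg' E'] := IHk _ Sa' g Sg.
  by rewrite mulrA E exprS; field.
by exists g' => //; rewrite exprS -mulrA -E'; field.
Qed.

(** * Spans of independent monomials *)

Inductive span (F : fieldType) (G : Type) (mon : G -> F) (R : F -> Prop)
    (H : G -> Prop) : F -> Prop :=
| span0 : span mon R H 0
| span_add c e f : R c -> H e -> span mon R H f -> span mon R H (c * mon e + f).

Definition indep (F : fieldType) (G : eqType) (mon : G -> F) (R : F -> Prop) :=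
  forall (s : seq G) (c : G -> F), uniq s -> (forall e, R (c e)) ->
    \sum_(e <- s) c e * mon e = 0 -> forall e, e \in s -> c e = 0.

Record subgroup (G : zmodType) (H : G -> Prop) : Prop := Subgroup {
  subgroup0 : H 0;
  subgroupB : forall a b, H a -> H b -> H (a - b) }.

Lemma subgroupN (G : zmodType) (H : G -> Prop) a : subgroup H -> H a -> H (- a).
Proof. by move=> sH Ha; rewrite -[- a]add0r; apply: subgroupB => //; apply: subgroup0. Qed.

Lemma subgroupD (G : zmodType) (H : G -> Prop) a b :
  subgroup H -> H a -> H b -> H (a + b).
Proof. by move=> sH Ha Hb; rewrite -[b]opprK; apply: subgroupB => //; apply: subgroupN. Qed.

Lemma subgroupMz (G : zmodType) (H : G -> Prop) a z : subgroup H -> H a -> H (a *~ z).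
Proof.
move=> sH Ha.
have Hn i : H (a *+ i).
  elim: i => [|i IHi]; first by rewrite mulr0n; apply: subgroup0.
  by rewrite mulrS; apply: subgroupD.
case: z => i; first by rewrite -pmulrn.
by rewrite NegzE mulrNz; apply: subgroupN => //; rewrite -pmulrn.
Qed.

Section Span.
Variables (F : fieldType) (G : zmodType) (mon : G -> F) (R : F -> Prop).
Hypotheses (subR : subring R) (mon0 : mon 0 = 1)
  (monD : forall a b, mon (a + b) = mon a * mon b).
Local Notation span := (span mon R).

Lemma mon_neq0 a : mon a != 0.
Proof.
apply/eqP=> a0; have : mon (a - a) = 0 by rewrite monD a0 mul0r.
by rewrite subrr mon0 => /eqP; rewrite oner_eq0.
Qed.

Lemma monN a : mon (- a) = (mon a)^-1.
Proof.
by apply: (mulfI (mon_neq0 a)); rewrite -monD subrr mon0 mulfV // mon_neq0.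
Qed.

Lemma monB a b : mon (a - b) = mon a / mon b.
Proof. by rewrite monD monN. Qed.

Lemma monMz a z : mon (a *~ z) = mon a ^ z.
Proof.
have monMn i : mon (a *+ i) = mon a ^+ i.
  elim: i => [|i IHi]; first by rewrite mulr0n expr0.
  by rewrite mulrS monD IHi exprS.
case: z => i; first by rewrite -pmulrn monMn.
by rewrite NegzE mulrNz monN -pmulrn monMn -exprnN.
Qed.

Lemma span_term (H : G -> Prop) c e : R c -> H e -> span H (c * mon e).
Proof. by move=> Rc He; rewrite -[_ * _]addr0; apply: span_add => //; apply: span0. Qed.

Lemma span_mon (H : G -> Prop) e : H e -> span H (mon e).
Proof. by rewrite -[mon e]mul1r; apply: span_term; apply: subring1. Qed.

Lemma span_scal (H : G -> Prop) c : H 0 -> R c -> span H c.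
Proof. by move=> H0 Rc; rewrite -[c]mulr1 -mon0; apply: span_term. Qed.

Lemma spanD (H : G -> Prop) f g : span H f -> span H g -> span H (f + g).
Proof.
by move=> + Hg; elim=> [|c e f' Rc He _ IH]; [rewrite add0r | rewrite -addrA; apply: span_add].
Qed.

Lemma spanZ (H : G -> Prop) c f : R c -> span H f -> span H (c * f).
Proof.
move=> Rc; elim=> [|c' e f' Rc' He _ IH]; first by rewrite mulr0; apply: span0.
by rewrite mulrDr mulrA; apply: span_add => //; apply: subringM.
Qed.

Lemma span_sub (H H' : G -> Prop) f :
  (forall e, H e -> H' e) -> span H f -> span H' f.
Proof.
move=> HH'; elim=> [|c e f' Rc He _ IH]; first exact: span0.
by apply: span_add => //; apply: HH'.
Qed.

Lemma span_shift (H H' : G -> Prop) v f :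
  (forall e, H e -> H' (e + v)) -> span H f -> span H' (f * mon v).
Proof.
move=> HH'; elim=> [|c e f' Rc He _ IH]; first by rewrite mul0r; apply: span0.
by rewrite mulrDl -mulrA -monD; apply: span_add => //; apply: HH'.
Qed.

Lemma span_subring (H : G -> Prop) : subgroup H -> subring (span H).
Proof.
move=> sH; split=> [|a b Ha Hb|a b Ha].
- by rewrite -mon0; apply: span_mon; apply: subgroup0.
- by apply: spanD => //; rewrite -mulN1r; apply: spanZ => //; apply: subringN => //;
    apply: subring1.
elim=> [|c e f' Rc He _ IH]; first by rewrite mulr0; apply: span0.
rewrite mulrDr; apply: spanD => //; rewrite mulrCA; apply: spanZ => //.
by apply: span_shift Ha => e' He'; apply: subgroupD.
Qed.

Lemma span_min (H : G -> Prop) (U : F -> Prop) f : subring U ->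
  (forall c, R c -> U c) -> (forall e, H e -> U (mon e)) -> span H f -> U f.
Proof.
move=> subU RU HU; elim=> [|c e f' Rc He _ IH]; first exact: subring0.
by apply: subringD => //; apply: subringM => //; [apply: RU | apply: HU].
Qed.

(** The coefficients are made to vanish outside the list, so that representations with different
    lists can be compared as functions in [rep_inj]. *)
Lemma span_rep (H : G -> Prop) f : span H f -> exists s c,
  [/\ uniq s, forall e, R (c e), forall e, e \notin s -> c e = 0,
      forall e, c e != 0 -> H e & f = \sum_(e <- s) c e * mon e].
Proof.
elim=> [|c e f' Rc He _ [s [c' [us Rc' c0 cH ->]]]].
  exists [::], (fun=> 0); split=> // [e|e|]; last by rewrite big_nil.
    exact: subring0.
  by rewrite eqxx.
exists (undup (e :: s)), (fun e' => c' e' + c *+ (e' == e)); split.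
- exact: undup_uniq.
- by move=> e'; apply: subringD => //; apply: subringMn.
- move=> e'; rewrite mem_undup inE negb_or => /andP[/negPf -> /c0 ->].
  by rewrite mulr0n addr0.
- move=> e'; case: (eqVneq e' e) => [-> //|_]; rewrite mulr0n addr0; apply: cH.
rewrite addrC; transitivity (\sum_(e' <- undup (e :: s)) c' e' * mon e'
    + \sum_(e' <- undup (e :: s)) c *+ (e' == e) * mon e'); last first.
  by rewrite -big_split; apply: eq_bigr => e' _; rewrite mulrDl.
congr (_ + _).
  rewrite /=; case: ifP => [es|/negbT es]; first by rewrite undup_id.
  by rewrite big_cons undup_id // c0 // mul0r add0r.
rewrite (bigD1_seq e) ?undup_uniq ?mem_undup ?mem_head //= eqxx mulr1n.
by rewrite big1 ?addr0 // => e' /negPf ->; rewrite mulr0n mul0r.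
Qed.

Lemma rep_widen (s S : seq G) (c : G -> F) : uniq s -> uniq S ->
  {subset s <= S} -> (forall e, e \notin s -> c e = 0) ->
  \sum_(e <- s) c e * mon e = \sum_(e <- S) c e * mon e.
Proof.
move=> us uS sS c0.
rewrite [RHS](bigID (mem s)) /= [X in _ = _ + X]big1 => [|e /c0 ->]; last by rewrite mul0r.
rewrite addr0 -[RHS]big_filter; apply: perm_big; apply: uniq_perm => //.
  exact: filter_uniq.
by move=> e; rewrite mem_filter /=; case: (boolP (e \in s)) => // /sS ->.
Qed.

Hypothesis ind : indep mon R.

Lemma rep_inj (s1 s2 : seq G) c1 c2 : uniq s1 -> uniq s2 ->
  (forall e, R (c1 e)) -> (forall e, R (c2 e)) ->
  (forall e, e \notin s1 -> c1 e = 0) -> (forall e, e \notin s2 -> c2 e = 0) ->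
  \sum_(e <- s1) c1 e * mon e = \sum_(e <- s2) c2 e * mon e -> c1 =1 c2.
Proof.
move=> us1 us2 Rc1 Rc2 c10 c20; set S := undup (s1 ++ s2).
have uS : uniq S by apply: undup_uniq.
rewrite (@rep_widen s1 S) // => [|e se]; last by rewrite mem_undup mem_cat se.
rewrite (@rep_widen s2 S) // => [|e se]; last by rewrite mem_undup mem_cat se orbT.
move=> E e; case: (boolP (e \in S)) => [eS|]; last first.
  by rewrite mem_undup mem_cat negb_or => /andP[/c10 -> /c20 ->].
apply/eqP; rewrite -subr_eq0; apply/eqP.
apply: (ind (c := fun e => c1 e - c2 e) uS) => // [e'|]; first exact: subringB.
under eq_bigr do rewrite mulrBl.
by rewrite sumrB E subrr.
Qed.

Lemma span_disjoint (H H' : G -> Prop) f :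
  (forall e, H e -> H' e -> False) -> span H f -> span H' f -> f = 0.
Proof.
move=> dis /span_rep [s [c [us Rc c0 cH ->]]] /span_rep [s' [c' [us' Rc' c0' cH' E]]].
apply: big1 => e _.
have cc := rep_inj us us' Rc Rc' c0 c0' E.
case: (eqVneq (c e) 0) => [->|ce]; first by rewrite mul0r.
by case: (dis e (cH e ce)); apply: cH'; rewrite -cc.
Qed.

(** * Gradings by an integral linear form and the prime 1 + mon v *)

Section Grading.
Variables (lam : G -> int) (v : G) (H : G -> Prop).
Hypotheses (lamD : forall a b, lam (a + b) = lam a + lam b) (lamv : lam v = 1)
  (sH : subgroup H) (Hv : H v).

Let lam0 : lam 0 = 0.
Proof. by apply: (addIr (lam 0)); rewrite -lamD !add0r. Qed.

Let lamN a : lam (- a) = - lam a.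
Proof. by apply: (addIr (lam a)); rewrite -lamD !addNr lam0. Qed.

Let lamMz a z : lam (a *~ z) = lam a * z.
Proof.
have lamMn i : lam (a *+ i) = lam a * i%:Z.
  elim: i => [|i IHi]; first by rewrite mulr0n mulr0.
  by rewrite mulrS lamD IHi; lia.
case: z => i; first by rewrite -pmulrn lamMn.
by rewrite NegzE mulrNz lamN -pmulrn lamMn mulrN.
Qed.

(** As [lam v = 1], H is the direct sum of [grade0] and the multiples of v; hence the span of H is a
    Laurent ring in [mon v] over the span of [grade0] ([span_lau]). *)
Definition grade0 (e : G) := H e /\ lam e = 0.

Lemma grade0_subgroup : subgroup grade0.
Proof.
split=> [|a b [Ha la] [Hb lb]]; first by split; [apply: subgroup0 | ].
by split; [apply: subgroupB | rewrite lamD lamN la lb].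
Qed.

(** In p(mon v) mon v + c = 0 the first term has only positive degrees and c has degree 0. By
    independence both vanish, and mon v can be cancelled. *)
Lemma grade0_transc : transc (span grade0) (mon v).
Proof.
have sub0 := span_subring grade0_subgroup.
elim/poly_ind => // p c IHp Sp.
have Sp' : polyS (span grade0) p.
  by move=> i; have := Sp i.+1; rewrite coefD coefMX coefC /= addr0.
have Sc : span grade0 c by have := Sp 0%N; rewrite coefD coefMX coefC /= add0r.
rewrite hornerMXaddC => E.
have pos : span (fun e => 0 <= lam e) p.[mon v].
  elim/poly_ind: p Sp' {IHp Sp E} => [_|p d IHp Sp].
    by rewrite horner0; apply: span0.
  rewrite hornerMXaddC; apply: spanD.
    apply: (@span_shift (fun e => 0 <= lam e)) => [e le|]; first by rewrite lamD lamv; lia.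
    by apply: IHp => i; have := Sp i.+1; rewrite coefD coefMX coefC /= addr0.
  apply: (@span_sub grade0) => [e [_ ->] //|].
  by have := Sp 0%N; rewrite coefD coefMX coefC /= add0r.
have c0 : c = 0.
  apply: (@span_disjoint grade0 (fun e => 0 < lam e)) => [e [_ ->]||]; rewrite ?ltxx //.
  have -> : c = - 1 * (p.[mon v] * mon v).
    by apply/eqP; rewrite mulN1r -subr_eq0 opprK addrC E.
  apply: spanZ; first by apply: subringN => //; apply: subring1.
  by apply: span_shift pos => e le; rewrite lamD lamv; lia.
have -> : p = 0.
  apply: IHp => //; move/eqP: E.
  by rewrite c0 addr0 mulf_eq0 (negPf (mon_neq0 v)) orbF => /eqP.
by rewrite c0 polyC0 mul0r addr0.
Qed.

Lemma span_lau f : span H f <-> lau (span grade0) (mon v) f.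
Proof.
have sub0 := span_subring grade0_subgroup.
have v0 := mon_neq0 v; have subL := lau_subring (mon v) sub0.
split.
  elim=> [|c e f' Rc He _ IH]; first exact: subring0.
  apply: subringD => //.
  have -> : c * mon e = c * mon (e - v *~ lam e) * mon v ^ lam e.
    by rewrite -mulrA -monMz -monD subrK.
  apply: (subringM subL); last first.
    apply: (subring_exprz subL); [exact: lau_var | exact: lau_varV].
  apply: lau_const => //; apply: span_term => //; split.
    by apply: subgroupB => //; apply: subgroupMz.
  by rewrite lamD lamN lamMz lamv mul1r subrr.
apply: lau_min => //; first exact: span_subring.
- by move=> a; apply: span_sub => e [].
- exact: span_mon.
- by rewrite -monN; apply: span_mon; apply: subgroupN.
Qed.

Lemma span_prime f g : span H f -> span H g -> span H (f * g / (1 + mon v)) ->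
  span H (f / (1 + mon v)) \/ span H (g / (1 + mon v)).
Proof.
rewrite !span_lau; apply: lau_prime_onex.
- by apply: span_subring; apply: grade0_subgroup.
- exact: mon_neq0.
- exact: grade0_transc.
Qed.

Lemma onemon_neq0 : 1 + mon v != 0.
Proof.
apply: onex_neq0 grade0_transc.
by apply: span_subring; apply: grade0_subgroup.
Qed.

(** Modulo 1 + mon v, mon u is up to sign mon h, where h = u - lam(u) v has degree 0. Divisibility
    makes mon h equal to 1 or -1, and independence forces h = 0. *)
Lemma span_dvd_onemon u : H u -> span H ((1 + mon u) / (1 + mon v)) ->
  exists z, u = v *~ z.
Proof.
move=> Hu; rewrite span_lau => dvd.
have sub0 := span_subring grade0_subgroup.
set h := u - v *~ lam u; exists (lam u); apply/eqP; rewrite -subr_eq0 -/h; apply/eqP.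
have Sh : span grade0 (mon h).
  apply: span_mon; split; first by apply: subgroupB => //; apply: subgroupMz.
  by rewrite lamD lamN lamMz lamv mul1r subrr.
have S1 : span grade0 1 by apply: subring1.
have uh : mon u = mon h * mon v ^ lam u by rewrite -monMz -monD subrK.
(* Two signs serve both cases: if [lam u] is negative, the power of mon v in the denominator is
   cleared first and the sign falls on the term 1. *)
suff [z1 [z2 E]] : exists z1 z2 : bool, (-1) ^+ z1 + (-1) ^+ z2 * mon h = 0.
  have signS (z : bool) : R ((-1) ^+ z).
    by apply: subringX => //; apply: subringN => //; apply: subring1.
  apply/eqP; apply/negPn/negP => h0.
  have := @span_disjoint (fun e => e = h) (fun e => e = 0) ((-1) ^+ z2 * mon h).
  move=> dis; suff : (-1) ^+ z2 * mon h = 0.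
    by move/eqP; rewrite mulf_eq0 signr_eq0 (negPf (mon_neq0 h)).
  apply: dis => [e -> /eqP||]; rewrite ?(negPf h0) //; first exact: span_term.
  have -> : (-1) ^+ z2 * mon h = - (-1) ^+ z1.
    by apply/eqP; rewrite -subr_eq0 opprK addrC E.
  by apply: span_scal => //; apply: subringN.
have sgn i : exists z : bool, (-1) ^+ i = (-1) ^+ z :> F.
  by exists (odd i); rewrite signr_odd.
have v0 := mon_neq0 v.
case luE: (lam u) => [i|i].
  pose p := 1%:P + (mon h)%:P * 'X^i.
  have Sp : polyS (span grade0) p.
    move=> j; rewrite coefD; apply: subringD => //; first exact: polySC.
    by apply: polySM => //; [apply: polySC | apply: polySXn].
  have Ep : (1 + mon u) * mon v ^+ 0 = p.[mon v].
    by rewrite hornerD hornerM hornerXn !hornerC mulr1 uh luE.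
  move/(lau_dvd_onex sub0 v0 grade0_transc Sp Ep): dvd.
  rewrite hornerD hornerM hornerXn !hornerC; have [z ->] := sgn i.
  by exists false, z; rewrite mulrC.
pose p := 'X^(i.+1) + (mon h)%:P.
have Sp : polyS (span grade0) p.
  move=> j; rewrite coefD; apply: subringD => //; first exact: polySXn.
  exact: polySC.
have Ep : (1 + mon u) * mon v ^+ i.+1 = p.[mon v].
  rewrite hornerD hornerXn hornerC uh luE NegzE -exprnN mulrDl mul1r.
  by rewrite mulfVK // expf_neq0.
move/(lau_dvd_onex sub0 v0 grade0_transc Sp Ep): dvd.
rewrite hornerD hornerXn !hornerC; have [z ->] := sgn i.+1.
by exists z, false; rewrite mul1r.
Qed.

Lemma span_onemon_nunit : ~ span H (1 / (1 + mon v)).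
Proof.
have sub0 := span_subring grade0_subgroup; rewrite span_lau.
have S1 : polyS (span grade0) 1%:P.
  by apply: (polySC sub0); apply: (subring1 sub0).
rewrite (lau_dvd_onex sub0 (mon_neq0 v) grade0_transc (s := 0%N) S1).
  by rewrite hornerC => /eqP; rewrite oner_eq0.
by rewrite hornerC mulr1.
Qed.

End Grading.
End Span.

Lemma indep_sub (F : fieldType) (G : eqType) (mon : G -> F) (R R' : F -> Prop) :
  (forall c, R' c -> R c) -> indep mon R -> indep mon R'.
Proof. by move=> R'R ind s c us Rc; apply: ind => // e; apply: R'R. Qed.

(** Coefficients over R are unique, so an expansion over the smaller ring R' must have a at e. *)
Lemma span_coef (F : fieldType) (G : zmodType) (mon : G -> F) (R R' : F -> Prop)
    (H : G -> Prop) a e : subring R -> subring R' ->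
  (forall c, R' c -> R c) -> indep mon R -> R a ->
  span mon R' H (a * mon e) -> R' a.
Proof.
move=> subR subR' R'R ind Ra /(span_rep subR') [s [c [us Rc c0 _ E]]].
suff <- : c e = a by [].
have /(_ e) : c =1 (fun e' => if e' == e then a else 0).
  apply: (rep_inj subR ind us (s2 := [:: e])) => // [e'|e'|e'|].
  - exact: R'R.
  - by case: ifP => // _; apply: subring0.
  - by rewrite inE => /negPf ->.
  by rewrite big_seq1 eqxx -E.
by rewrite eqxx.
Qed.

(** * Subtraction-free expressions and their tropical degree *)

Section Positive.
Variables (F : fieldType) (G : zmodType) (mon : G -> F) (R : F -> Prop).
Hypotheses (subR : subring R) (mon0 : mon 0 = 1)
  (monD : forall a b, mon (a + b) = mon a * mon b) (ind : indep mon R).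
Hypothesis char0 : forall i : nat, i%:R = 0 :> F -> i = 0%N.

Lemma sum_mon_count (s S : seq G) : uniq S -> {subset s <= S} ->
  \sum_(e <- s) mon e = \sum_(e <- S) (count_mem e s)%:R * mon e.
Proof.
move=> uS; elim: s => [|e s IHs] sS.
  by rewrite big_nil big1 // => e _; rewrite mul0r.
rewrite big_cons IHs => [|e' se']; last by apply: sS; rewrite inE se' orbT.
transitivity (\sum_(e' <- S) (e == e')%:R * mon e'
    + \sum_(e' <- S) (count_mem e' s)%:R * mon e').
  congr (_ + _); rewrite (bigD1_seq e) ?sS ?mem_head //= eqxx mul1r big1 ?addr0 //.
  by move=> e' /negPf ee'; rewrite eq_sym ee' mul0r.
by rewrite -big_split /=; apply: eq_bigr => e' _; rewrite -mulrDl -natrD.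
Qed.

Lemma natr_inj0 i j : i%:R = j%:R :> F -> i = j.
Proof.
wlog leij : i j / (i <= j)%N => [th|].
  by case/orP: (leq_total i j) => h E; [apply: th | apply/esym/th].
move=> E; apply/eqP; rewrite eqn_leq leij /= -subn_eq0; apply/eqP/char0.
by rewrite natrB // E subrr.
Qed.

(** Multiplicities are natural numbers, which characteristic 0 keeps apart, so sums of monomials
    never cancel. *)
Lemma sum_mon_inj (s1 s2 : seq G) :
  \sum_(e <- s1) mon e = \sum_(e <- s2) mon e -> s1 =i s2.
Proof.
set S := undup (s1 ++ s2) => E e.
have uS : uniq S := undup_uniq _.
have sS1 : {subset s1 <= S} by move=> x xs; rewrite mem_undup mem_cat xs.
have sS2 : {subset s2 <= S} by move=> x xs; rewrite mem_undup mem_cat xs orbT.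
move: E; rewrite (sum_mon_count uS sS1) (sum_mon_count uS sS2) => E.
have C : count_mem e s1 = count_mem e s2.
  have [eS|] := boolP (e \in S); last first.
    rewrite mem_undup mem_cat negb_or => /andP[/count_memPn -> /count_memPn ->] //.
  apply: natr_inj0; apply/eqP; rewrite -subr_eq0; apply/eqP.
  apply: (ind (c := fun e => (count_mem e s1)%:R - (count_mem e s2)%:R) uS) => //.
    by move=> e'; apply: (subringB subR); apply: (subringMn subR); apply: (subring1 subR).
  under eq_bigr do rewrite mulrBl.
  by rewrite sumrB E subrr.
by rewrite -!has_pred1 !has_count C.
Qed.

Variable lam : G -> int.
Hypothesis lamD : forall a b, lam (a + b) = lam a + lam b.

(** Sums of monomials of least degree 0, this degree being attained. Their quotients, [gpos], are
    the subtraction-free fractions of tropical value 0. *)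
Definition pmon f := exists s : seq G, [/\ forall e, e \in s -> 0 <= lam e,
  exists2 e, e \in s & lam e = 0 & f = \sum_(e <- s) mon e].

Definition gpos x := exists p q, [/\ pmon p, pmon q & x = p / q].

Lemma pmon_neq0 p : pmon p -> p != 0.
Proof.
move=> [s [_ [e es _] ->]]; apply/eqP=> E.
have /sum_mon_inj/(_ e) : \sum_(e <- s) mon e = \sum_(e <- [::]) mon e.
  by rewrite big_nil.
by rewrite es in_nil.
Qed.

Lemma pmonM p q : pmon p -> pmon q -> pmon (p * q).
Proof.
move=> [s [s0 [e es le] ->]] [s' [s0' [e' es' le'] ->]].
exists [seq a + b | a <- s, b <- s']; split.
- move=> _ /allpairsP[[a b] [/= as_ bs ->]]; rewrite lamD.
  by apply: addr_ge0; [apply: s0 | apply: s0'].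
- by exists (e + e'); [apply: allpairs_f | rewrite lamD le le'].
rewrite big_allpairs_dep mulr_suml; apply: eq_bigr => a _.
by rewrite mulr_sumr; apply: eq_bigr => b _; rewrite monD.
Qed.

Lemma pmon_addM p q e : pmon p -> pmon q -> 0 <= lam e -> pmon (p + mon e * q).
Proof.
move=> [s [s0 [a as_ la] ->]] [s' [s0' _ ->]] le.
exists (s ++ [seq e + b | b <- s']); split.
- move=> b; rewrite mem_cat => /orP[/s0 //|/mapP[b' bs ->]].
  by rewrite lamD; apply: addr_ge0 => //; apply: s0'.
- by exists a => //; rewrite mem_cat as_.
by rewrite big_cat big_map mulr_sumr; congr (_ + _); apply: eq_bigr => b _; rewrite monD.
Qed.

Lemma gpos_mon e : lam e = 0 -> gpos (mon e).
Proof.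
move=> le; exists (mon e), 1; split; last by rewrite divr1.
  exists [:: e]; split; last by rewrite big_seq1.
    by move=> a; rewrite inE => /eqP ->; rewrite le.
  by exists e; rewrite ?mem_head.
have l0 : lam 0 = 0 by apply: (addIr (lam 0)); rewrite -lamD !add0r.
exists [:: 0]; split; last by rewrite big_seq1.
  by move=> a; rewrite inE => /eqP ->; rewrite l0.
by exists 0; rewrite ?mem_head.
Qed.

Lemma gposM x y : gpos x -> gpos y -> gpos (x * y).
Proof.
move=> [p [q [pp pq ->]]] [p' [q' [pp' pq' ->]]].
exists (p * p'), (q * q'); split; [exact: pmonM | exact: pmonM |].
by rewrite invfM mulrACA.
Qed.

Lemma gposV x : gpos x -> gpos x^-1.
Proof. by move=> [p [q [pp pq ->]]]; exists q, p; rewrite invf_div. Qed.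

Lemma gpos1 : gpos 1.
Proof. by rewrite -mon0; apply: gpos_mon; apply: (addIr (lam 0)); rewrite -lamD !add0r. Qed.

Lemma gpos_exprz x z : gpos x -> gpos (x ^ z).
Proof.
move=> gx; have gX i : gpos (x ^+ i).
  by elim: i => [|i IHi]; [rewrite expr0; apply: gpos1 | rewrite exprS; apply: gposM].
by case: z => i; rewrite ?NegzE -?exprnN; [exact: gX | apply: gposV].
Qed.

(** Tropically, min(0, lam e) = 0: only the first summand has to attain the minimum. *)
Lemma gpos_addM x y e : gpos x -> gpos y -> 0 <= lam e -> gpos (x + mon e * y).
Proof.
move=> [p [q [pp pq ->]]] [p' [q' [pp' pq' ->]]] le.
exists (p * q' + mon e * (p' * q)), (q * q'); split; last 2 first.
- exact: pmonM.
- by have := pmon_neq0 pq; have := pmon_neq0 pq' => h h'; field; rewrite h h'.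
by apply: pmon_addM => //; apply: pmonM.
Qed.

(** In mon e q = p both sides have the same support, hence the same least degree: lam e on the left,
    0 on the right. *)
Lemma gpos_monE e : gpos (mon e) -> lam e = 0.
Proof.
move=> [p [q [pp pq E]]].
have q0 := pmon_neq0 pq; move: pp pq E q0.
move=> [s [s0 [a as_ la] ->]] [s' [s0' [b bs lb] ->]] E q0.
have /sum_mon_inj S : \sum_(e <- s) mon e = \sum_(e' <- [seq e + b | b <- s']) mon e'.
  rewrite big_map -[LHS](mulfVK q0) -E mulr_sumr.
  by apply: eq_bigr => b' _; rewrite monD.
move: as_; rewrite S => /mapP[b' /s0' lb' aE].
have /s0 : e + b \in s by rewrite S; apply: map_f.
by move: la; rewrite aE !lamD lb; lia.
Qed.

(** Otherwise p + mon e q would be a nonempty sum of monomials equal to 0. *)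
Lemma gpos_Nmon e : ~ gpos (- mon e).
Proof.
move=> [p [q [pp pq E]]].
have q0 := pmon_neq0 pq; move: pp pq E q0.
move=> [s [_ [a as_ la] ->]] [s' [_ _ ->]] E q0.
have /sum_mon_inj S : \sum_(e' <- s ++ [seq e + b | b <- s']) mon e'
    = \sum_(e' <- [::]) mon e'.
  rewrite big_cat big_map big_nil /= -[X in X + _](mulfVK q0) -E.
  under [X in _ + X]eq_bigr do rewrite monD.
  by rewrite -mulr_sumr mulNr addNr.
by have := S a; rewrite mem_cat as_ in_nil.
Qed.

End Positive.

Lemma eq_mon_span (F : fieldType) (G : Type) (mon mon' : G -> F) R (H : G -> Prop) f :
  (forall e, H e -> mon e = mon' e) -> span mon R H f -> span mon' R H f.
Proof.
move=> E; elim=> [|c e f' Rc He _ IH]; first exact: span0.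
by rewrite E //; apply: span_add.
Qed.

(** * Exchange relations in rank two *)

Section Rank2.
Variables (F : fieldType) (W : F -> Prop).
Hypothesis subW : subring W.

Lemma denom_subring z : W z -> subring (fun f => exists r, W (f * z ^+ r)).
Proof.
move=> Wz; split=> [|a b [r Wa] [s Wb]|a b [r Wa] [s Wb]].
- by exists 0%N; rewrite mulr1; apply: subring1.
- exists (r + s)%N; rewrite mulrBl {1}exprD addnC exprD !mulrA.
  by apply: subringB => //; apply: subringM => //; apply: subringX.
exists (r + s)%N; rewrite exprD mulrACA.
by apply: subringM.
Qed.

(** W[1/y] and W[1/z] meet in W: in f = a (f y) + b (f z) each of f y and f z needs one factor less
    in a denominator. *)
Lemma comaximal_mem (y z a b f : F) : W y -> W z -> W a -> W b ->
  a * y + b * z = 1 ->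
  (exists r, W (f * z ^+ r)) -> (exists s, W (f * y ^+ s)) -> W f.
Proof.
move=> Wy Wz Wa Wb ab1 [r Wr] [s Ws].
have [N] := ubnP (r + s)%N; elim: N => // N IHN in r s f Wr Ws * => leN.
case: r Wr leN => [|r] Wr; first by rewrite mulr1 in Wr.
case: s Ws => [|s] Ws leN; first by rewrite mulr1 in Ws.
have -> : f = a * (f * y) + b * (f * z) by rewrite -[LHS]mulr1 -ab1; ring.
apply: subringD => //; apply: subringM => //.
  apply: (IHN r.+1 s); last by lia.
    by rewrite mulrAC; apply: subringM.
  by rewrite -mulrA -exprS.
apply: (IHN r s.+1); last by lia.
  by rewrite -mulrA -exprS.
by rewrite mulrAC; apply: subringM.
Qed.

Lemma expr_split (g h y : F) b : W g -> W h -> W y ->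
  exists2 q, W q & (g + h * y) ^+ b = g ^+ b + q * y.
Proof.
move=> Wg Wh Wy; elim: b => [|b [q Wq E]].
  by exists 0; [apply: subring0 | rewrite mul0r addr0].
exists (h * g ^+ b + (g + h * y) * q); last by rewrite !exprS E; ring.
apply: subringD => //; apply: subringM => //; first exact: subringX.
by apply: subringD => //; apply: subringM.
Qed.

(** The rank two core of the Laurent phenomenon: z1 and y2 are the variables after mutation at z and
    then at y, and W is a ring in which they are invertible. *)
Lemma rank2_mem (al be ga de rho y z y1 z1 y2 : F) (b c : nat) :
  W al -> W be -> W ga -> W de -> W rho -> W be^-1 -> W ga^-1 -> W rho^-1 ->
  W z1 -> W z1^-1 -> W y2 -> W y2^-1 ->
  y != 0 -> z1 != 0 -> y2 != 0 -> ga != 0 -> rho != 0 ->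
  y * y1 = al * z ^+ b + be -> z * z1 = ga + de * y ^+ c.+1 ->
  y * y2 = rho * (be * z1 ^+ b + al * ga ^+ b) ->
  [/\ W y, W z & W y1].
Proof.
move=> Wal Wbe Wga Wde Wrho WbeV WgaV WrhoV Wz1 Wz1V Wy2 Wy2V y0 z10 y20 ga0 rho0.
move=> yy1 zz1 yy2.
have WM := subringM subW; have WD := subringD subW; have WX := subringX.
have Wy : W y.
  have -> : y = rho * (be * z1 ^+ b + al * ga ^+ b) * y2^-1 by rewrite -yy2 mulfK.
  by apply: (WM) => //; apply: (WM) => //; apply: (WD); apply: (WM) => //; apply: (WX).
have Wz : W z.
  have -> : z = (ga + de * y ^+ c.+1) * z1^-1 by rewrite -zz1 mulfK.
  by apply: (WM) => //; apply: (WD) => //; apply: (WM) => //; apply: (WX).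
split=> //.
have [] := @expr_split ga (de * y ^+ c) y b => // [|q Wq].
  by apply: (WM) => //; apply: (WX).
rewrite -mulrA -exprSr -zz1 => E.
(* As (z z1)^b = ga^b + q y, multiplying the relation for y y2 by z^b / rho gives z^b y y2 / rho =
   ga^b (al z^b + be) + be q y = ga^b y y1 + be q y. *)
have -> : y1 = ga^-1 ^+ b * (rho^-1 * z ^+ b * y2 - be * q).
  apply: (mulfI y0); rewrite yy1.
  have -> : y * (ga^-1 ^+ b * (rho^-1 * z ^+ b * y2 - be * q)) =
    ga^-1 ^+ b * (rho^-1 * z ^+ b * (y * y2) - be * (q * y)) by ring.
  have -> : q * y = z ^+ b * z1 ^+ b - ga ^+ b.
    by rewrite -exprMn E addrC addKr.
  rewrite yy2 exprVn.
  have := expf_neq0 b ga0; move: (ga ^+ b) (z ^+ b) (z1 ^+ b) => g Z Z1 g0.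
  by field; rewrite g0 rho0.
apply: (WM); first exact: (WX).
by apply: (subringB subW); apply: (WM) => //; apply: (WM) => //; apply: (WX).
Qed.

End Rank2.

(** * Monomials with integer exponents, and positive parts of exponent vectors *)

Definition mon (F : fieldType) (N : nat) (w : 'I_N -> F) (e : 'cV[int]_N) : F :=
  \prod_i w i ^ e i 0.

Definition posv (N : nat) (e : 'cV[int]_N) : 'cV[int]_N := \col_i Num.max (e i 0) 0.

Lemma mulrz_coef N (e : 'cV[int]_N) z i : (e *~ z) i 0 = e i 0 * z.
Proof. by rewrite -scaler_int mxE intz mulrC. Qed.

Lemma posvB N (e : 'cV[int]_N) : posv e - posv (- e) = e.
Proof.
by apply/matrixP=> i j; rewrite !mxE ord1; move: (e i 0) => a; case: leP; case: leP; lia.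
Qed.

Section Monomial.
Variables (F : fieldType) (N : nat) (w : 'I_N -> F).
Hypothesis w0 : forall i, w i != 0.

Lemma mon_0 : mon w 0 = 1.
Proof. by apply: big1 => i _; rewrite mxE expr0z. Qed.

Lemma mon_D a b : mon w (a + b) = mon w a * mon w b.
Proof. by rewrite -big_split; apply: eq_bigr => i _; rewrite mxE expfzDr. Qed.

Lemma mon_delta i : mon w (delta_mx i 0) = w i.
Proof.
rewrite /mon (bigD1 i) //= mxE !eqxx big1 ?mulr1 // => j ji.
by rewrite mxE (negPf ji).
Qed.

Lemma eq_mon (w' : 'I_N -> F) (e : 'cV[int]_N) : (forall i, e i 0 != 0 -> w i = w' i) ->
  mon w e = mon w' e.
Proof.
move=> E; apply: eq_bigr => i _; case: (eqVneq (e i 0) 0) => [->|/E -> //].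
by rewrite !expr0z.
Qed.

Lemma mon_posv e : mon w (posv e) + mon w (posv (- e)) =
  mon w (posv (- e)) * (1 + mon w e).
Proof.
rewrite mulrDr mulr1 -mon_D addrC; congr (_ + mon w _).
by rewrite -[X in _ = _ + X]posvB addrC subrK.
Qed.

End Monomial.

(** * The upper bound is invariant under mutation *)

(* [w t] lists the extended cluster and [u t k] is the k-th column of the    *)
(* extended exchange matrix at t; [nb k t] is the k-th neighbour of t.       *)
Record pattern (F : fieldType) (n m : nat) (T : Type) (nb : 'I_n -> T -> T)
    (w : T -> 'I_(n + m) -> F) (u : T -> 'I_n -> 'cV[int]_(n + m)) : Prop := Pattern {
  nbK : forall k t, nb k (nb k t) = t;
  nb_ind : forall (P : T -> Prop) t0, P t0 -> (forall k t, P t -> P (nb k t)) ->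
    forall t, P t;
  w_neq0 : forall t i, w t i != 0;
  w_out : forall k t i, i != lshift m k -> w (nb k t) i = w t i;
  w_exch : forall k t, w t (lshift m k) * w (nb k t) (lshift m k)
    = mon (w t) (posv (u t k)) + mon (w t) (posv (- u t k));
  u_same : forall k t, u (nb k t) k = - u t k;
  u_out : forall k t j, j != k -> u (nb k t) j = u t j
    + posv (u t k) *~ Num.max (u t j (lshift m k) 0) 0
    - posv (- u t k) *~ Num.max (- u t j (lshift m k) 0) 0
    - delta_mx (lshift m k) 0 *~ (2 * u t j (lshift m k) 0);
  u_diag : forall t k, u t k (lshift m k) 0 = 0;
  u_sign : forall t j k, Num.sg (u t j (lshift m k) 0) = - Num.sg (u t k (lshift m j) 0);
  u_prim : forall t k, exists l : 'rV[int]_(n + m), (l *m u t k) 0 0 = 1;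
  u_nonmult : forall t j k z, j != k -> u t k <> u t j *~ z }.

Section Star.
Variables (F : fieldType) (n m : nat) (T : Type) (nb : 'I_n -> T -> T)
  (w : T -> 'I_(n + m) -> F) (u : T -> 'I_n -> 'cV[int]_(n + m)) (R : F -> Prop).
Hypotheses (pat : pattern nb w u) (subR : subring R)
  (ind : forall t, indep (mon (w t)) R).
Local Notation io := (@lshift n m).
Local Notation G := 'cV[int]_(n + m).

Let w0 t := w_neq0 pat t.
Let mon0 t : mon (w t) 0 = 1 := mon_0 (w t).
Let monD t a b : mon (w t) (a + b) = mon (w t) a * mon (w t) b := mon_D (w0 t) a b.

Definition all_exp (e : G) := True.
Definition no_exp (j : 'I_n) (e : G) := e (io j) 0 = 0.

(** Cluster and frozen variables are treated alike and all inverted, so [R] holds scalars only.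
    [Sring t j] leaves out A_j and is therefore shared by t and its j-th neighbour. *)
Definition Lring t := span (mon (w t)) R all_exp.
Definition Sring t j := span (mon (w t)) R (no_exp j).
Definition exch t k := mon (w t) (posv (u t k)) + mon (w t) (posv (- u t k)).

Lemma all_exp_subgroup : subgroup all_exp. Proof. by []. Qed.

Lemma no_exp_subgroup j : subgroup (no_exp j).
Proof. by split=> [|a b]; rewrite /no_exp !mxE // => -> ->. Qed.

Lemma Lring_subring t : subring (Lring t).
Proof. exact: span_subring (monD t) _ all_exp_subgroup. Qed.

Lemma Sring_subring t j : subring (Sring t j).
Proof. exact: span_subring (monD t) _ (no_exp_subgroup j). Qed.

Lemma Sring_nb t j f : Sring (nb j t) j f <-> Sring t j f.
Proof.
have E e : no_exp j e -> mon (w (nb j t)) e = mon (w t) e.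
  move=> je; apply: eq_mon => i ei; apply: (w_out pat).
  by apply: contra_neq ei => ->.
by split; apply: eq_mon_span => e /E.
Qed.

Lemma coord_lau t j f : Lring t f <-> lau (Sring t j) (w t (io j)) f.
Proof.
rewrite -(mon_delta (w t) (io j)).
have := @span_lau F G (mon (w t)) R subR (mon0 t) (monD t)
  (fun e : G => e (io j) 0) (delta_mx (io j) 0) all_exp _ _ all_exp_subgroup _ f.
move=> h; rewrite /Lring h //; last 2 first.
- by move=> a b; rewrite mxE.
- by rewrite mxE !eqxx.
have E e : grade0 (fun e : G => e (io j) 0) all_exp e <-> no_exp j e.
  by split=> [[]|].
split=> [] [s [p [Sp fp]]]; exists s, p; split=> // i;
  by apply: span_sub (Sp i) => e /E.
Qed.

Lemma coord_transc t j : transc (Sring t j) (w t (io j)).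
Proof.
rewrite -(mon_delta (w t) (io j)) => p Sp.
apply: (@grade0_transc F G (mon (w t)) R subR (mon0 t) (monD t) (@ind t)
  (fun e : G => e (io j) 0) (delta_mx (io j) 0) all_exp) => //.
- by move=> a b; rewrite mxE.
- by rewrite mxE !eqxx.
by move=> i; apply: span_sub (Sp i).
Qed.

Lemma coord_lau_nb t j f : Lring (nb j t) f <-> lau (Sring t j) (w (nb j t) (io j)) f.
Proof.
rewrite (coord_lau _ j); split=> [] [s [p [Sp fp]]]; exists s, p; split=> // i;
  by apply/Sring_nb.
Qed.

Lemma Lring_mon t e : Lring t (mon (w t) e).
Proof. exact: span_mon. Qed.

Lemma Lring_w t i : Lring t (w t i) /\ Lring t (w t i)^-1.
Proof.
rewrite -(mon_delta (w t) i) -(monN (mon0 t) (monD t)).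
by split; apply: Lring_mon.
Qed.

Lemma Lring_S t j a : Sring t j a -> Lring t a.
Proof. exact: span_sub. Qed.

Lemma exchE t k : exch t k = mon (w t) (posv (- u t k)) * (1 + mon (w t) (u t k)).
Proof. exact: mon_posv. Qed.

Lemma posv0 (e : G) i : e i 0 <= 0 -> posv e i 0 = 0.
Proof. by rewrite mxE; case: leP; lia. Qed.

Lemma no_exp_posv j e : no_exp j e -> no_exp j (posv e).
Proof. by move=> e0; apply: posv0; rewrite e0. Qed.

Lemma exch_S t k j : no_exp j (u t k) -> Sring t j (exch t k).
Proof.
move=> ujk; apply: spanD; apply: span_mon => //; apply: no_exp_posv => //.
by apply: subgroupN => //; apply: no_exp_subgroup.
Qed.

Lemma primv t k : exists lam : G -> int,
  (forall a b, lam (a + b) = lam a + lam b) /\ lam (u t k) = 1.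
Proof.
have [l lu] := u_prim pat t k; exists (fun e : G => (l *m e) 0 0); split=> // a b.
by rewrite mulmxDr mxE.
Qed.

Lemma exch_neq0 t k : exch t k != 0.
Proof.
have [lam [lamD lamu]] := primv t k.
rewrite exchE mulf_neq0 ?(mon_neq0 (mon0 t) (monD t)) //.
exact: (onemon_neq0 subR (mon0 t) (monD t) (@ind t) lamD lamu all_exp_subgroup).
Qed.

Lemma span_div_exch t k H f : subgroup H -> H (posv (- u t k)) ->
  span (mon (w t)) R H (f / exch t k) <-> span (mon (w t)) R H (f / (1 + mon (w t) (u t k))).
Proof.
move=> sH Hk; have subH := span_subring subR (mon0 t) (monD t) sH.
have k0 := mon_neq0 (mon0 t) (monD t) (posv (- u t k)).
rewrite exchE invfM; set x := (1 + _)^-1; split=> h.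
  have -> : f * x = f * ((mon (w t) (posv (- u t k)))^-1 * x) * mon (w t) (posv (- u t k)).
    by field.
  by apply: (subringM subH) => //; apply: span_mon.
rewrite mulrCA mulrC; apply: (subringM subH) => //.
rewrite -(monN (mon0 t) (monD t)); apply: span_mon => //.
exact: subgroupN.
Qed.

(** P_j is prime in [Sring t j] and does not divide P_k, for otherwise u_k would be a multiple of
    u_j. *)
Lemma exch_coprime t j k a : j != k -> no_exp j (u t k) ->
  Sring t j a -> Sring t j (exch t k * a / exch t j) -> Sring t j (a / exch t j).
Proof.
move=> jk ujk Sa.
have sH := no_exp_subgroup j.
have Hj : no_exp j (u t j) by apply: (u_diag pat).
have HN i : no_exp j (u t i) -> no_exp j (posv (- u t i)).
  by move=> ui; apply: no_exp_posv; apply: subgroupN.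
have subS := Sring_subring t j.
rewrite /Sring !(span_div_exch _ sH (HN _ Hj)) => h.
have [lam [lamD lamu]] := primv t j.
have k0 := mon_neq0 (mon0 t) (monD t) (posv (- u t k)).
have h' : Sring t j ((1 + mon (w t) (u t k)) * a / (1 + mon (w t) (u t j))).
  have -> : (1 + mon (w t) (u t k)) * a / (1 + mon (w t) (u t j)) =
     (mon (w t) (posv (- u t k)))^-1 * (exch t k * a / (1 + mon (w t) (u t j))).
    by rewrite exchE !mulrA mulVf // mul1r.
  apply: (subringM subS) => //; rewrite -(monN (mon0 t) (monD t)); apply: span_mon => //.
  by apply: subgroupN => //; apply: HN.
have Suk : Sring t j (1 + mon (w t) (u t k)).
  by apply: (subringD subS); [apply: (subring1 subS) | apply: span_mon].
have [] := span_prime subR (mon0 t) (monD t) (@ind t) lamD lamu sH Hj Suk Sa h' => //.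
move=> /(span_dvd_onemon subR (mon0 t) (monD t) (@ind t) lamD lamu sH Hj ujk) [z E].
by case: (u_nonmult pat jk E).
Qed.

Lemma mon_nb k t e : no_exp k e -> mon (w (nb k t)) e = mon (w t) e.
Proof.
move=> ke; apply: eq_mon => i ei; apply: (w_out pat).
by apply: contra_neq ei => ->.
Qed.

(** By [lau_exch_mem], f is a polynomial in A_i and its mutation over [Sring t i], whose monomials
    lie in W up to a power of A_l. *)
Lemma denom_exch (W : F -> Prop) t i l f : subring W ->
  (forall c, R c -> W c) ->
  (forall e, no_exp i e -> no_exp l e -> W (mon (w t) e)) -> i != l ->
  W (w t (io i)) -> W (w t (io l)) -> W (w (nb i t) (io i)) ->
  Lring t f -> Lring (nb i t) f -> exists r, W (f * w t (io l) ^+ r).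
Proof.
move=> subW RW Wmon il Wi Wl Wi'; rewrite (coord_lau _ i) coord_lau_nb.
have subD := denom_subring subW Wl.
have WD a : W a -> exists r, W (a * w t (io l) ^+ r).
  by move=> Wa; exists 0%N; rewrite mulr1.
have Si : Sring t i (exch t i) by apply: exch_S; apply: (u_diag pat).
apply: (lau_exch_mem (Sring_subring t i) (w0 t _) (@coord_transc t i)
  (w0 _ _) (w_exch pat i t) Si subD); [|exact: WD|exact: WD].
move=> a; apply: (span_min subD); first by move=> c /RW /WD.
move=> e ie.
set d : G := delta_mx (io l) 0; set z := e (io l) 0.
have We : W (mon (w t) (e - d *~ z)).
  have iol : (io i == io l) = false by rewrite (inj_eq (@lshift_inj _ _)) (negPf il).
  apply: Wmon; rewrite /no_exp !mxE.
    by rewrite mulrz_coef mxE iol ie mul0r subr0.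
  by rewrite mulrz_coef mxE !eqxx mul1r subrr.
have -> : mon (w t) e = mon (w t) (e - d *~ z) * w t (io l) ^ z.
  by rewrite -(mon_delta (w t)) -(monMz (mon0 t) (monD t)) -monD subrK.
case: z We => r We.
  by apply: WD; apply: (subringM subW) => //; apply: subringX.
by exists r.+1; rewrite NegzE -exprnN mulfVK // expf_neq0.
Qed.

Lemma io_neq i l : i != l -> io i == io l = false.
Proof. by rewrite (inj_eq (@lshift_inj _ _)) => /negPf. Qed.

Lemma mon_nb2 j k t e : no_exp j e -> no_exp k e ->
  mon (w (nb j (nb k t))) e = mon (w t) e.
Proof. by move=> je ke; rewrite !mon_nb. Qed.

(** Exponent bookkeeping for [step_pos]: the positive part of the mutated column u_j', read off from
    the column mutation rule. *)
Lemma posv_mut (p q p' q' g d v v' : G) (b : int) : p - q = v' -> p' - q' = v ->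
  v' = v + g *~ b - d *~ (2 * b) ->
  p = q - d *~ b - q' + (p' - d *~ b + g *~ b).
Proof.
move=> pq <- v'E; have -> : p = v' + q by rewrite -pq subrK.
rewrite v'E; apply/matrixP=> i l; rewrite ord1 !(mulrz_coef, mxE); ring.
Qed.

(** The linked case. In W = L(mu_j mu_k t) the exchange relation at j expresses a unit through A_j
    and A_k, so these are comaximal; f lies in W[1/A_k] by the pair t, mu_j t and in W[1/A_j] by the
    pair t, mu_k t. The columns are arguments so that the opposite sign follows by negating them. *)
Lemma step_pos t j k (uj uk uj' : G) (b c : nat) : j != k ->
  uj (io j) 0 = 0 -> uj (io k) 0 = b.+1 -> uk (io k) 0 = 0 ->
  uk (io j) 0 = - c.+1%:Z ->
  uj' = uj + posv uk *~ b.+1 - delta_mx (io k) 0 *~ (2 * b.+1) ->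
  w t (io j) * w (nb j t) (io j) = mon (w t) (posv uj) + mon (w t) (posv (- uj)) ->
  w t (io k) * w (nb k t) (io k) = mon (w t) (posv uk) + mon (w t) (posv (- uk)) ->
  w t (io j) * w (nb j (nb k t)) (io j)
    = mon (w (nb k t)) (posv uj') + mon (w (nb k t)) (posv (- uj')) ->
  forall f, Lring t f -> Lring (nb k t) f -> Lring (nb j t) f ->
    Lring (nb j (nb k t)) f.
Proof.
move=> jk ujj ujk ukk ukj uj'E yy1 zz1 yy2 f ft ft' fj.
have kj : k != j by rewrite eq_sym.
have jkF := io_neq jk; have kjF := io_neq kj.
set W := Lring (nb j (nb k t)); have subW : subring W := Lring_subring _.
have RW a : R a -> W a by apply: span_scal.
have Wmon e : no_exp j e -> no_exp k e -> W (mon (w t) e).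
  by move=> je ke; rewrite -(mon_nb2 t je ke); apply: Lring_mon.
have WmonV e : no_exp j e -> no_exp k e -> W (mon (w t) e)^-1.
  move=> je ke; rewrite -(monN (mon0 t) (monD t)).
  by apply: Wmon; apply: subgroupN => //; apply: no_exp_subgroup.
set ej : G := delta_mx (io j) 0; set ek : G := delta_mx (io k) 0.
have coord := (@mulrz_coef, ukj, ujj, ujk, ukk, jkF, kjF, eqxx, mxE).
pose vin e := no_exp j e /\ no_exp k e.
(* [al], [be] are the exponents of the terms of P_j without A_k; [ga], [de] those of P_k without
   A_j; [rh] is that of the common factor of the terms of P_j at mu_k t. None involves A_j or A_k,
   so these monomials are units of W. *)
pose al := posv uj - ek *~ b.+1; pose be := posv (- uj); pose ga := posv uk.
pose de := posv (- uk) - ej *~ c.+1; pose rh := posv (- uj') - ek *~ b.+1 - be.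
have hal : vin al by split; rewrite /no_exp !coord /=; lia.
have hbe : vin be by split; rewrite /no_exp !coord /=; lia.
have hga : vin ga by split; rewrite /no_exp !coord /=; lia.
have hde : vin de by split; rewrite /no_exp !coord /=; lia.
have hrh : vin rh by split; rewrite /no_exp /rh uj'E !coord /=; lia.
case: hal hbe hga hde hrh => ? ? [? ?] [? ?] [? ?] [? ?].
have me e : mon (w t) e != 0 by apply: (mon_neq0 (mon0 t) (monD t)).
have [Wz1 Wz1V] : W (w (nb k t) (io k)) /\ W (w (nb k t) (io k))^-1.
  by rewrite -(@w_out _ _ _ _ _ _ _ pat j) ?kjF //; apply: Lring_w.
have [Wy2 Wy2V] := Lring_w (nb j (nb k t)) (io j).
have yy1E : w t (io j) * w (nb j t) (io j) =
    mon (w t) al * w t (io k) ^+ b.+1 + mon (w t) be.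
  rewrite yy1; congr (_ + _).
  rewrite -(mon_delta (w t) (io k)) (exprnP _ b.+1).
  by rewrite -(monMz (mon0 t) (monD t)) -monD subrK.
have zz1E : w t (io k) * w (nb k t) (io k) =
    mon (w t) ga + mon (w t) de * w t (io j) ^+ c.+1.
  rewrite zz1; congr (_ + _).
  rewrite -(mon_delta (w t) (io j)) (exprnP _ c.+1).
  by rewrite -(monMz (mon0 t) (monD t)) -monD subrK.
have yy2E : w t (io j) * w (nb j (nb k t)) (io j) = mon (w t) rh *
    (mon (w t) be * w (nb k t) (io k) ^+ b.+1 + mon (w t) al * mon (w t) ga ^+ b.+1).
  set z1 := w (nb k t) (io k).
  have z1E z : z1 ^ z = mon (w (nb k t)) (ek *~ z).
    by rewrite (monMz (mon0 _) (monD _)) mon_delta.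
  have mk e : no_exp k e -> mon (w t) e = mon (w (nb k t)) e by move=> /mon_nb ->.
  rewrite yy2 (exprnP z1) (exprnP _ b.+1) z1E -(monMz (mon0 t) (monD t)) !mk //; last first.
    by apply: subgroupMz => //; apply: no_exp_subgroup.
  rewrite -!monD mulrDr -!monD addrC; congr (_ + _); congr (mon _ _).
    by rewrite /rh addrA subrK subrK.
  by rewrite (posv_mut (posvB uj') (posvB uj) uj'E).
have [] := rank2_mem subW (Wmon al _ _) (Wmon be _ _) (Wmon ga _ _) (Wmon de _ _)
  (Wmon rh _ _) (WmonV be _ _) (WmonV ga _ _) (WmonV rh _ _) Wz1 Wz1V Wy2 Wy2V
  (w0 _ _) (w0 _ _) (w0 _ _) (me _) (me _) yy1E zz1E yy2E => // Wy Wz Wy1.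
have yz1 : w (nb j t) (io j) / mon (w t) be * w t (io j)
    + (- (mon (w t) al * w t (io k) ^+ b) / mon (w t) be) * w t (io k) = 1.
  have -> : w (nb j t) (io j) / mon (w t) be * w t (io j)
    + (- (mon (w t) al * w t (io k) ^+ b) / mon (w t) be) * w t (io k)
    = (w t (io j) * w (nb j t) (io j) - mon (w t) al * w t (io k) ^+ b.+1)
       / mon (w t) be by rewrite exprSr; ring.
  by rewrite yy1E addrAC subrr add0r mulfV.
apply: (comaximal_mem subW Wy Wz _ _ yz1).
- by apply: (subringM subW) => //; apply: WmonV.
- apply: (subringM subW); last exact: WmonV.
  apply: (subringN subW); apply: (subringM subW); first exact: Wmon.
  exact: subringX.
- by apply: (denom_exch subW RW Wmon jk Wy Wz Wy1 ft fj).
have Wz1' : W (w (nb k t) (io k)) by [].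
apply: (denom_exch subW RW _ kj Wz Wy Wz1' ft ft') => e ke je.
exact: Wmon.
Qed.

(** The unlinked case. Mutation at k changes neither P_j nor P_k. As A_k times its mutation is P_k,
    some P_k^r f lies in W, and P_k can be cancelled because it is coprime to P_j. *)
Lemma step_zero t j k f : j != k -> u t j (io k) 0 = 0 ->
  Lring t f -> Lring (nb k t) f -> Lring (nb j t) f -> Lring (nb j (nb k t)) f.
Proof.
move=> jk ujk ft ft' fj.
have kj : k != j by rewrite eq_sym.
set t' := nb k t; set W := Lring (nb j t').
have subW : subring W := Lring_subring _.
have RW a : R a -> W a by apply: span_scal.
have Wmon e : no_exp j e -> no_exp k e -> W (mon (w t) e).
  by move=> je ke; rewrite -(mon_nb2 t je ke); apply: Lring_mon.
have ukj : u t k (io j) 0 = 0.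
  by apply/eqP; rewrite -sgr_eq0 -oppr_eq0 -(u_sign pat) ujk sgr0.
have ujj := u_diag pat t j; have ukk := u_diag pat t k.
have uj' : u t' j = u t j.
  by rewrite (u_out pat) // ujk oppr0 maxxx mulr0z !addr0.
have no_posN i l : no_exp i (u t l) -> no_exp i (posv (- u t l)).
  by move=> h; apply: no_exp_posv; apply: subgroupN => //; apply: no_exp_subgroup.
have Wexch i : no_exp j (u t i) -> no_exp k (u t i) -> W (exch t i).
  by move=> ji ki; apply: (subringD subW); apply: Wmon; do ?apply: no_posN; do ?apply: no_exp_posv.
have exch_nb i : no_exp k (u t i) -> u t' i = u t i \/ i = k -> exch t' i = exch t i.
  move=> ki [E|->]; last by rewrite /exch (u_same pat) opprK addrC !mon_nb //;
    do ?apply: no_posN => //; do ?apply: no_exp_posv.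
  by rewrite /exch E !mon_nb //; do ?apply: no_posN => //; do ?apply: no_exp_posv.
have Ej : exch t' j = exch t j by apply: exch_nb => //; left.
have Ek : exch t' k = exch t k by apply: exch_nb => //; right.
have yE : w t' (io j) = w t (io j) by rewrite (w_out pat) // io_neq.
have y2E : w (nb j t') (io j) = w (nb j t) (io j).
  apply: (mulfI (w0 t (io j))); rewrite -{1}yE (w_exch pat) -/(exch t' j) Ej.
  by rewrite (w_exch pat).
have [Wy2 Wy2V] := Lring_w (nb j t') (io j).
have [Wz1 Wz1V] : W (w t' (io k)) /\ W (w t' (io k))^-1.
  by rewrite -(@w_out _ _ _ _ _ _ _ pat j) ?io_neq //; apply: Lring_w.
have Wy : W (w t (io j)).
  have -> : w t (io j) = exch t j * (w (nb j t') (io j))^-1.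
    by rewrite y2E /exch -(w_exch pat) mulfK.
  by apply: (subringM subW) => //; apply: Wexch.
have Wz : W (w t (io k)).
  have -> : w t (io k) = exch t k * (w t' (io k))^-1.
    by rewrite /exch -(w_exch pat) mulfK.
  by apply: (subringM subW) => //; apply: Wexch.
have Wy1 : W (w (nb j t) (io j)) by rewrite -y2E.
have [r Wfr] := denom_exch subW RW Wmon jk Wy Wz Wy1 ft fj.
have {Wfr} : W (exch t k ^+ r * f).
  have -> : exch t k ^+ r * f = w t' (io k) ^+ r * (f * w t (io k) ^+ r).
    by rewrite /exch -(w_exch pat) exprMn; ring.
  by apply: (subringM subW) => //; apply: (subringX subW).
have Lex : Lring t' (exch t' k).
  by apply: (@Lring_S _ j); apply: exch_S; rewrite (u_same pat); apply: subgroupN => //;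
    apply: no_exp_subgroup.
(* The factors P_k are cancelled one by one, each remaining P_k^r f lying in L(t'). *)
rewrite -Ek; elim: r => [|r IHr]; first by rewrite mul1r.
rewrite exprS -mulrA => Wr; apply: IHr; apply/(coord_lau_nb t' j).
have Sk : Sring t' j (exch t' k).
  by apply: exch_S; rewrite (u_same pat); apply: subgroupN => //; apply: no_exp_subgroup.
have Sj : Sring t' j (exch t' j) by apply: exch_S; apply: (u_diag pat).
apply: (lau_exch_coprime (Sring_subring t' j) (w0 t' (io j)) (@coord_transc t' j)
  (w0 _ _) (w_exch pat j t') Sj Sk); last by apply/(coord_lau_nb t' j).
  move=> a; apply: exch_coprime => //.
  by rewrite (u_same pat); apply: subgroupN => //; apply: no_exp_subgroup.
apply/coord_lau; have subL := Lring_subring t'.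
by apply: (subringM subL) => //; apply: (subringX subL).
Qed.

Lemma upper_bound_step t j k f : j != k ->
  Lring t f -> Lring (nb k t) f -> Lring (nb j t) f -> Lring (nb j (nb k t)) f.
Proof.
move=> jk; have sg := u_sign pat t j k; have uj' := u_out pat t jk.
have ujj := u_diag pat t j; have ukk := u_diag pat t k.
have yE : w t (io j) = w (nb k t) (io j) by rewrite (w_out pat) // io_neq.
case ujkE : (u t j (io k) 0) sg uj' => [[|b]|b] sg uj'.
- by move=> ft ft' fj; apply: step_zero.
- case ukjE : (u t k (io j) 0) sg => [[|c]|c] // sg.
  apply: (@step_pos t j k (u t j) (u t k) (u (nb k t) j) b c) => //.
  + by rewrite uj' max_l ?max_r ?mulr0z ?subr0 //; lia.
  + exact: (w_exch pat).
  + exact: (w_exch pat).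
  + by rewrite yE; apply: (w_exch pat).
case ukjE : (u t k (io j) 0) sg => [[|c]|c] // sg.
apply: (@step_pos t j k (- u t j) (- u t k) (- u (nb k t) j) b c) => //;
  rewrite ?opprK.
+ by rewrite mxE ujj oppr0.
+ by rewrite mxE ujkE.
+ by rewrite mxE ukk oppr0.
+ by rewrite mxE ukjE.
+ rewrite uj' max_r ?max_l ?mulr0z ?addr0 //.
  apply/matrixP=> i l; rewrite ord1 !(mulrz_coef, mxE) NegzE; ring.
+ by rewrite [RHS]addrC; apply: (w_exch pat).
+ by rewrite [RHS]addrC; apply: (w_exch pat).
by rewrite [RHS]addrC yE; apply: (w_exch pat).
Qed.

Definition upper f := forall t, Lring t f.

(* The upper bound L(t) /\ L(nb k t) is the same at every vertex t. *)
Lemma starfish t f : Lring t f -> (forall k, Lring (nb k t) f) -> upper f.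
Proof.
move=> ft fn.
have: forall t', Lring t' f /\ forall k, Lring (nb k t') f.
  apply: (nb_ind pat (t0 := t)) => // k t' [ft' fn']; split=> // j.
  by have [->|jk] := eqVneq j k; [rewrite (nbK pat) | apply: upper_bound_step].
by move=> h t'; case: (h t').
Qed.

Lemma upper_subring : subring upper.
Proof.
split=> [|a b Ua Ub|a b Ua Ub] t.
- exact: (subring1 (Lring_subring t)).
- exact: (subringB (Lring_subring t)).
- exact: (subringM (Lring_subring t)).
Qed.

Lemma upper_scal c : R c -> upper c.
Proof. by move=> Rc t; apply: span_scal. Qed.

Lemma Lring_w_nb t k : Lring (nb k t) (w t (io k)).
Proof.
have subL := Lring_subring (nb k t).
have -> : w t (io k) = exch (nb k t) k * (w (nb k t) (io k))^-1.
  by rewrite /exch -(w_exch pat) (nbK pat) mulrC mulKf.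
apply: (subringM subL); last by case: (Lring_w (nb k t) (io k)).
by apply: (@Lring_S _ k); apply: exch_S; apply: (u_diag pat).
Qed.

(** By [starfish] only t and its neighbours matter; across the edge k, A_k is P_k divided by the new
    variable. *)
Lemma laurent_phenomenon t i : upper (w t i).
Proof.
apply: (@starfish t) => [|k]; first by case: (Lring_w t i).
have [->|ik] := eqVneq i (io k); first exact: Lring_w_nb.
by rewrite -(@w_out _ _ _ _ _ _ _ pat k) //; case: (Lring_w (nb k t) i).
Qed.

(** A_k is invertible in L(t) and in L(mu_j t) for j other than k, so only the neighbour across k
    can obstruct the division. *)
Lemma upper_div_nb t k x : upper x ->
  Lring (nb k t) (x / w t (io k)) -> upper (x / w t (io k)).
Proof.
move=> Ux h.
have nbV i t' : Lring t' (w t i)^-1 -> Lring t' (x / w t i).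
  by move=> h'; apply: (subringM (Lring_subring t')).
apply: (@starfish t) => [|j]; first by apply: nbV; case: (Lring_w t (io k)).
have [->//|jk] := eqVneq j k.
apply: nbV; have <- : w (nb j t) (io k) = w t (io k).
  by rewrite (w_out pat) // eq_sym io_neq.
by case: (Lring_w (nb j t) (io k)).
Qed.

Lemma upper_div t k x : upper x ->
  upper (x / w t (io k)) <-> Lring (nb k t) (x / (1 + mon (w (nb k t)) (u (nb k t) k))).
Proof.
move=> Ux; have subL := Lring_subring (nb k t).
have [Lw LwV] := Lring_w (nb k t) (io k).
have e0 := exch_neq0 (nb k t) k.
have wE : w t (io k) = exch (nb k t) k / w (nb k t) (io k).
  by rewrite /exch -(w_exch pat) (nbK pat) mulrC mulKf.
have E : Lring (nb k t) (x / w t (io k)) <-> Lring (nb k t) (x / exch (nb k t) k).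
  have wn := w0 (nb k t) (io k).
  have -> : x / w t (io k) = x / exch (nb k t) k * w (nb k t) (io k).
    by rewrite wE; field; rewrite e0 wn.
  split=> h; last exact: (subringM subL).
  by rewrite -[x / _](mulfK wn); apply: (subringM subL).
rewrite /Lring -(@span_div_exch (nb k t) k all_exp x all_exp_subgroup I).
rewrite -/(Lring (nb k t) _) -E.
by split=> [|h]; [exact | apply: upper_div_nb].
Qed.

Lemma upper_w_prime t k x y : upper x -> upper y -> upper (x * y / w t (io k)) ->
  upper (x / w t (io k)) \/ upper (y / w t (io k)).
Proof.
move=> Ux Uy; have Uxy : upper (x * y) by apply: (subringM upper_subring).
rewrite !upper_div //; have [lam [lamD lamu]] := primv (nb k t) k.
exact: (span_prime subR (mon0 _) (monD _) (@ind _) lamD lamu all_exp_subgroup I (Ux _) (Uy _)).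
Qed.

Lemma upper_w_nunit t k : ~ upper (1 / w t (io k)).
Proof.
rewrite upper_div; last exact: (subring1 upper_subring).
have [lam [lamD lamu]] := primv (nb k t) k.
exact: (span_onemon_nunit subR (mon0 _) (monD _) (@ind _) lamD lamu all_exp_subgroup I).
Qed.

End Star.

(** * Comparing two clusters *)

Definition int_scal (F : fieldType) (x : F) := exists z : int, x = z%:~R.

Lemma int_scal_subring (F : fieldType) : subring (@int_scal F).
Proof.
split=> [|_ _ [a ->] [b ->]|_ _ [a ->] [b ->]]; first by exists 1.
  by exists (a - b); rewrite rmorphB.
by exists (a * b); rewrite rmorphM.
Qed.

Lemma int_scal_sub (F : fieldType) (R : F -> Prop) c : subring R -> int_scal c -> R c.
Proof.
move=> subR [[i|i] ->]; rewrite ?NegzE ?mulrNz.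
  by apply: (subringMn subR); apply: (subring1 subR).
apply: (subringN subR); apply: (subringMn subR); exact: (subring1 subR).
Qed.

Section Final.
Variables (F : fieldType) (n m : nat) (T : Type) (nb : 'I_n -> T -> T)
  (w : T -> 'I_(n + m) -> F) (u : T -> 'I_n -> 'cV[int]_(n + m)) (R : F -> Prop).
Hypotheses (pat : pattern nb w u) (subR : subring R)
  (ind : forall t, indep (mon (w t)) R).
Hypothesis char0 : forall i : nat, i%:R = 0 :> F -> i = 0%N.
Local Notation io := (@lshift n m).
Local Notation G := 'cV[int]_(n + m).

Let w0 t := w_neq0 pat t.
Let mon0 t : mon (w t) 0 = 1 := mon_0 (w t).
Let monD t a b : mon (w t) (a + b) = mon (w t) a * mon (w t) b := mon_D (w0 t) a b.
Local Notation upper := (upper w R).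
Let subU : subring upper := upper_subring pat subR.

Lemma w_frozen t t' l : w t (rshift n l) = w t' (rshift n l).
Proof.
apply: (nb_ind pat (P := fun t' => w t (rshift n l) = w t' (rshift n l)) (t0 := t)) t' => // k t' ->.
by rewrite (w_out pat) // eq_rlshift.
Qed.

Lemma upper_frozenV t l : upper (w t (rshift n l))^-1.
Proof. by move=> t'; rewrite (w_frozen t t'); case: (Lring_w pat subR t' (rshift n l)). Qed.

(* [None], the zero degree, serves to fix signs even when m = 0. *)
Definition zdeg (o : option 'I_m) (e : G) : int :=
  if o is Some l then e (rshift n l) 0 else 0.

Lemma zdegD o a b : zdeg o (a + b) = zdeg o a + zdeg o b.
Proof. by case: o => [l|] //=; rewrite mxE. Qed.

(* Tropical evaluation: subtraction-free expressions keep zdeg 0. *)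
Lemma cluster_gpos t0 o t j : gpos (mon (w t0)) (zdeg o) (w t (io j)).
Proof.
have gM := gposM (monD t0) (zdegD o).
have gV x : gpos (mon (w t0)) (zdeg o) x -> gpos (mon (w t0)) (zdeg o) x^-1 := @gposV _ _ _ _ _.
apply: (nb_ind pat (P := fun t => forall j, gpos (mon (w t0)) (zdeg o) (w t (io j)))
  (t0 := t0)) t j => [j|k t IHt j].
  rewrite -(mon_delta (w t0)); apply: (gpos_mon (mon0 t0) (zdegD o)).
  by case: o {gM gV} => [l|] //=; rewrite mxE eq_rlshift.
have [->|jk] := eqVneq j k; last by rewrite (w_out pat) ?io_neq //; apply: IHt.
have -> : w (nb k t) (io k) = (w t (io k))^-1 *
    (mon (w t) (posv (u t k)) + mon (w t) (posv (- u t k))).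
  by rewrite -(w_exch pat) mulKf.
apply: (gM); first exact: gV.
(* A monomial at t is a subtraction-free fraction of degree 0 times its frozen part, which carries
   the whole degree. *)
have split_mon v : exists2 x, gpos (mon (w t0)) (zdeg o) x &
    mon (w t) v = x * mon (w t0) (col_mx 0 (dsubmx v)).
  exists (\prod_(i < n) w t (io i) ^ v (io i) 0).
    elim/big_ind: _ => [||i _]; [exact: (gpos1 (mon0 t0) (zdegD o)) | exact: gM |].
    by apply: (gpos_exprz (mon0 t0) (monD t0) (zdegD o)); apply: IHt.
  rewrite /mon !big_split_ord /=; congr (_ * _); rewrite [X in X * _]big1 ?mul1r.
    by apply: eq_bigr => i _; rewrite (w_frozen t t0) col_mxEd mxE.
  by move=> i _; rewrite col_mxEu mxE expr0z.
have zd v : zdeg o (col_mx 0 (dsubmx v)) = zdeg o v.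
  by case: o {gM gV IHt split_mon} => [l|] //=; rewrite col_mxEd mxE.
have [x gx ->] := split_mon (posv (u t k)); have [y gy ->] := split_mon (posv (- u t k)).
have zpos v : 0 <= zdeg o (posv v).
  by case: o {gM gV IHt split_mon zd gx gy} => [l|] //=; rewrite mxE le_max lexx orbT.
(* The positive and negative parts of u_k do not both involve the l-th frozen variable, so one of
   the two terms has degree 0. *)
have [z|z] : zdeg o (posv (u t k)) = 0 \/ zdeg o (posv (- u t k)) = 0.
- case: o {gM gV IHt split_mon zd gx gy zpos} => [l|] /=; last by left.
  by rewrite !mxE; move: (u t k _ _) => a; case: leP; case: leP; lia.
- rewrite [y * _]mulrC; apply: (gpos_addM subR (monD t0) (@ind t0) char0 (zdegD o)) => //.
    by apply: (gM) => //; apply: (gpos_mon (mon0 t0) (zdegD o)); rewrite zd.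
  by rewrite zd.
rewrite addrC [x * _]mulrC; apply: (gpos_addM subR (monD t0) (@ind t0) char0 (zdegD o)) => //.
  by apply: (gM) => //; apply: (gpos_mon (mon0 t0) (zdegD o)); rewrite zd.
by rewrite zd.
Qed.

(** The variables are split off one at a time by [lau_unit]. [H s] holds the exponents that vanish
    on the variables already treated; after all of them only scalars remain. *)
Lemma Lring_unit t c : c != 0 -> Lring w R t c -> Lring w R t c^-1 ->
  exists a e, [/\ R a, R a^-1 & c = a * mon (w t) e].
Proof.
move=> c0 Lc LcV.
pose H (s : seq 'I_(n + m)) (e : G) := forall i, i \in s -> e i 0 = 0.
have sH s : subgroup (H s).
  split=> [|a b Ha Hb] i is_; first by rewrite mxE.
  by rewrite !mxE Ha // Hb // subrr.
have [a [e [a0 Sa SaV ->]]] : exists a e, [/\ a != 0,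
    span (mon (w t)) R (H (enum 'I_(n + m))) a,
    span (mon (w t)) R (H (enum 'I_(n + m))) a^-1 & c = a * mon (w t) e].
  elim: (enum _) => [|i s [a [e [a0 Sa SaV ->]]]].
    exists c, 0; rewrite mon0 mulr1.
    by split=> //; [apply: span_sub Lc | apply: span_sub LcV].
  have [his|nis] := boolP (i \in s).
    have E f : span (mon (w t)) R (H s) f -> span (mon (w t)) R (H (i :: s)) f.
      by apply: span_sub => e' He' l; rewrite inE => /predU1P[->|]; apply: He'.
    by exists a, e; split=> //; apply: E.
  pose v : G := delta_mx i 0; pose lam (e : G) := e i 0.
  have lamD a' b' : lam (a' + b') = lam a' + lam b' by rewrite /lam mxE.
  have lamv : lam v = 1 by rewrite /lam mxE !eqxx.
  have Hv : H s v by move=> l ls; rewrite mxE; have [li|//] := eqVneq l i; rewrite -li ls in nis.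
  have sub0 := span_subring subR (mon0 t) (monD t) (grade0_subgroup lamD (sH s)).
  have := lau_unit sub0 (mon_neq0 (mon0 t) (monD t) v)
    (grade0_transc subR (mon0 t) (monD t) (@ind t) lamD lamv (sH s)) a0.
  rewrite -!(span_lau subR (mon0 t) (monD t) lamD lamv (sH s) Hv).
  case=> // b [z [Sb SbV aE]]; exists b, (v *~ z + e).
  have E f : span (mon (w t)) R (grade0 lam (H s)) f -> span (mon (w t)) R (H (i :: s)) f.
    by apply: span_sub => e' [He' le'] l; rewrite inE => /predU1P[->//|]; apply: He'.
  split; [|exact: E|exact: E|]; last by rewrite monD (monMz (mon0 t) (monD t)) mulrA -aE.
  by apply: contra_neq a0 => b0; rewrite aE b0 mul0r.
have R_of f : span (mon (w t)) R (H (enum 'I_(n + m))) f -> R f.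
  elim=> [|b e' f' Rb He' _ IH]; first exact: (subring0 subR).
  apply: (subringD subR) => //; have -> : e' = 0.
    by apply/matrixP=> i l; rewrite ord1 mxE; apply: He'; rewrite mem_enum.
  by rewrite mon0 mulr1.
by exists a, e; split=> //; apply: R_of.
Qed.

(** If A_j occurred in the unit, A_j would be a unit of L(mu_j t), where the other factors are
    units, and then 1 / A_j would lie in U. *)
Lemma upper_unit t c : c != 0 -> upper c -> upper c^-1 ->
  exists a e, [/\ R a, R a^-1, c = a * mon (w t) e & forall j, no_exp j e].
Proof.
move=> c0 Uc UcV; have [a [e [Ra RaV cE]]] := Lring_unit c0 (Uc t) (UcV t).
have a0 : a != 0 by apply: contra_neq c0 => a0; rewrite cE a0 mul0r.
exists a, e; split=> // j.
have me0 := mon_neq0 (mon0 t) (monD t) e.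
have Ue : upper (mon (w t) e).
  have -> : mon (w t) e = a^-1 * c by rewrite cE mulKf.
  by apply: (subringM subU) => //; apply: upper_scal.
have UeV : upper (mon (w t) e)^-1.
  have -> : (mon (w t) e)^-1 = a * c^-1 by rewrite cE invfM mulrA mulfV ?mul1r.
  by apply: (subringM subU) => //; apply: upper_scal.
apply/eqP/negPn/negP => z0.
apply: (@upper_w_nunit _ _ _ _ _ _ _ _ pat subR ind t j).
apply: (upper_div_nb pat subR ind); first exact: (subring1 subU).
set L := Lring w R (nb j t).
have subL : subring L := Lring_subring pat subR (nb j t).
have Lwj : L (w t (io j)) by apply: (laurent_phenomenon pat subR ind).
pose e' := e - delta_mx (io j) 0 *~ e (io j) 0.
have je' : no_exp j e' by rewrite /no_exp !mxE mulrz_coef mxE !eqxx mul1r subrr.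
have eE : mon (w t) e = mon (w t) e' * w t (io j) ^ e (io j) 0.
  by rewrite -(mon_delta (w t) (io j)) -(monMz (mon0 t) (monD t)) -monD subrK.
have LmN x : no_exp j x -> L (mon (w t) x).
  by move=> jx; rewrite -(mon_nb pat t jx); apply: Lring_mon.
have LzN : L (w t (io j) ^ (- e (io j) 0)).
  have -> : w t (io j) ^ (- e (io j) 0) = mon (w t) e' * (mon (w t) e)^-1.
    rewrite eE invfM mulrA mulfV ?(mon_neq0 (mon0 t) (monD t)) // mul1r.
    by rewrite -invr_expz.
  by apply: (subringM subL); [apply: LmN | apply: UeV].
have Lz : L (w t (io j) ^ e (io j) 0).
  have -> : w t (io j) ^ e (io j) 0 = mon (w t) (- e') * mon (w t) e.
    by rewrite eE (monN (mon0 t) (monD t)) mulKf ?(mon_neq0 (mon0 t) (monD t)).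
  apply: (subringM subL); last exact: Ue.
  by apply: LmN; apply: subgroupN => //; apply: no_exp_subgroup.
have LX i : L (w t (io j) ^- i.+1) -> L (1 / w t (io j)).
  move=> h; have -> : 1 / w t (io j) = w t (io j) ^- i.+1 * w t (io j) ^+ i.
    have h0 := w0 t (io j); rewrite exprSr; have := expf_neq0 i h0.
    by move: (w t (io j) ^+ i) => x x0; field; rewrite x0 h0.
  by apply: (subringM subL) => //; apply: (subringX subL).
case: (e (io j) 0) z0 Lz LzN => [[|i]|i] // _ Lz LzN.
  by apply: LX (i) _; rewrite -exprnN in LzN.
by apply: LX (i) _; rewrite NegzE -exprnN in Lz.
Qed.

(* A unit ratio of two cluster variables is a monomial in the frozen         *)
(* variables with a coefficient that is a unit of Z, because the Laurent     *)
(* phenomenon holds over Z; positivity then makes it trivial.                *)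
Lemma unit_ratio t k t0 i :
  upper (w t (io k) / w t0 (io i)) -> upper (w t0 (io i) / w t (io k)) ->
  w t (io k) = w t0 (io i).
Proof.
move=> Uc UcV; set c := w t (io k) / w t0 (io i) in Uc.
have UcV' : upper c^-1 by rewrite invf_div.
have c0 : c != 0 by rewrite mulf_neq0 ?invr_eq0.
have [a [e [Ra RaV cE je]]] := upper_unit t0 c0 Uc UcV'.
have a0 : a != 0 by apply: contra_neq c0 => a0; rewrite cE a0 mul0r.
have indZ t1 : indep (mon (w t1)) (@int_scal F).
  by apply: indep_sub (@ind t1) => x; apply: int_scal_sub.
have RZ (x : F) : int_scal x -> R x by apply: int_scal_sub.
have wk : w t (io k) = a * mon (w t0) (e + delta_mx (io i) 0).
  by rewrite monD mon_delta mulrA -cE mulfVK.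
(* e is purely frozen, so it gives the same monomial at t and t0. Thus A_(i;t0) is the inverse of a
   times a monomial at t, and this inverse is an integer too. *)
have wi : w t0 (io i) = a^-1 * (mon (w t) (delta_mx (io k) 0 - col_mx 0 (dsubmx e))).
  have -> : mon (w t) (delta_mx (io k) 0 - col_mx 0 (dsubmx e)) =
     w t (io k) / mon (w t0) e.
    rewrite (monB (mon0 t) (monD t)) mon_delta; congr (_ / _).
    have {2}-> : e = col_mx 0 (dsubmx e).
      rewrite -[LHS]vsubmxK; congr (col_mx _ _).
      by apply/matrixP=> x y; rewrite !mxE ord1; apply: je.
    rewrite /mon !big_split_ord /=; congr (_ * _); apply: eq_bigr => l _.
      by rewrite col_mxEu mxE !expr0z.
    by rewrite (w_frozen t t0).
  have e0 := mon_neq0 (mon0 t0) (monD t0) e.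
  by rewrite wk monD mon_delta; field; rewrite a0 e0.
have [z az] : int_scal a.
  apply: (span_coef (H := @all_exp n m) subR (int_scal_subring F) RZ (@ind t0) Ra
    (e := e + delta_mx (io i) 0)).
  by rewrite -wk; apply: (laurent_phenomenon pat (int_scal_subring F) indZ).
have [z' az'] : int_scal a^-1.
  apply: (span_coef (H := @all_exp n m) subR (int_scal_subring F) RZ (@ind t) RaV
    (e := delta_mx (io k) 0 - col_mx 0 (dsubmx e))).
  by rewrite -wi; apply: (laurent_phenomenon pat (int_scal_subring F) indZ).
have zz : z * z' = 1.
  have : (z * z' - 1)%:~R = 0 :> F by rewrite intrB intrM -az -az' mulfV // subrr.
  move: (z * z') => x; rewrite -{2}[x](subrK 1); move: (x - 1) => [y|y].
    by move/char0=> ->.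
  by rewrite NegzE mulrNz => /eqP; rewrite oppr_eq0 => /eqP/char0.
have gc o : gpos (mon (w t0)) (zdeg o) c.
  apply: (gposM (monD t0) (zdegD o)); first exact: cluster_gpos.
  by apply: gposV; apply: cluster_gpos.
have [z1|zN1] : z = 1 \/ z = - 1.
  have /eqP : (`|z| * `|z'|)%N = 1%N by rewrite -abszM zz.
  by rewrite muln_eq1 => /andP[/eqP z1 _]; lia.
  rewrite az z1 mul1r in cE.
  have e0 : e = 0.
    apply/matrixP=> x y; rewrite ord1 mxE -[x]splitK; case: (split x) => l /=.
      exact: je.
    have := gc (Some l); rewrite cE.
    by move/(gpos_monE subR (monD t0) (@ind t0) char0 (zdegD (Some l))).
  have c1 : c = 1 by rewrite cE e0 mon0.
  by rewrite -[LHS](mulfVK (w0 t0 (io i))) -/c c1 mul1r.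
have := gc None; rewrite cE az zN1 mulN1r.
by move/(gpos_Nmon subR (monD t0) (@ind t0) char0).
Qed.

(** Let A_(i;t0) = g A_(k;t). The prime A_(i;t0) divides g, making A_(k;t) a unit, or it divides
    A_(k;t), making the two associates and hence equal. *)
Lemma cluster_not_dvd t k t0 i : w t (io k) <> w t0 (io i) ->
  ~ upper (w t0 (io i) / w t (io k)).
Proof.
move=> neq Ug.
have Uw := laurent_phenomenon pat subR ind.
have [||||Uki] := @upper_w_prime _ _ _ _ _ _ _ _ pat subR ind t0 i
   (w t0 (io i) / w t (io k)) (w t (io k)) => //.
- by rewrite mulfVK // mulfV //; apply: (subring1 subU).
- rewrite mulrAC mulfV // mul1r -[_^-1]mul1r.
  exact: (upper_w_nunit pat subR ind).
by apply: neq; apply: unit_ratio.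
Qed.

Lemma clusters_not_dvd t k t0 (s : seq 'I_n) :
  (forall i, w t (io k) <> w t0 (io i)) ->
  ~ upper (\prod_(i <- s) w t0 (io i) / w t (io k)).
Proof.
move=> neq; elim: s => [|i s IHs].
  by rewrite big_nil; apply: (upper_w_nunit pat subR ind).
have Uw := laurent_phenomenon pat subR ind.
have Us : upper (\prod_(i <- s) w t0 (io i)) by apply: subring_prod.
rewrite big_cons => h; have [] := upper_w_prime pat subR ind (Uw t0 (io i)) Us h => //.
exact: cluster_not_dvd.
Qed.

(** The elements with such a denominator form a ring that contains the scalars, the variables and
    their inverses. *)
Lemma Lring_denom t f : Lring w R t f ->
  exists s : seq 'I_n, upper (f * \prod_(j <- s) w t (io j)).
Proof.
have Uw := laurent_phenomenon pat subR ind.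
have Uprod (s : seq 'I_n) : upper (\prod_(j <- s) w t (io j)) by apply: subring_prod.
pose D f := exists s : seq 'I_n, upper (f * \prod_(j <- s) w t (io j)).
have subD : subring D.
  split=> [|a b [s Ua] [s' Ub]|a b [s Ua] [s' Ub]].
  - by exists [::]; rewrite big_nil mulr1; apply: (subring1 subU).
  - exists (s ++ s'); rewrite big_cat mulrBl.
    apply: (subringB subU); first by rewrite mulrA; apply: (subringM subU).
    by rewrite mulrCA; apply: (subringM subU).
  by exists (s ++ s'); rewrite big_cat mulrACA; apply: (subringM subU).
have UD a : upper a -> D a by move=> Ua; exists [::]; rewrite big_nil mulr1.
apply: (span_min subD) => [c Rc|e _]; first by apply: UD; apply: upper_scal.
apply: (subring_prod subD) => i _; apply: (subring_exprz subD); first exact: UD.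
rewrite -[i]splitK; case: (split i) => l /=; last by apply: UD; apply: upper_frozenV.
by exists [:: l]; rewrite big_seq1 mulVf //; apply: (subring1 subU).
Qed.

Theorem upper_two_clusters t t0 f : (forall i j, w t (io i) <> w t0 (io j)) ->
  Lring w R t f -> Lring w R t0 f -> upper f.
Proof.
move=> disj /Lring_denom[s Us] /Lring_denom[s0 Us0].
have Uw := laurent_phenomenon pat subR ind.
elim: s Us => [|k s IHs]; first by rewrite big_nil mulr1.
rewrite big_cons => Us; apply: IHs.
have Up (s' : seq 'I_n) : upper (\prod_(j <- s') w t (io j)) by apply: subring_prod.
have Up0 : upper (\prod_(j <- s0) w t0 (io j)) by apply: subring_prod.
(* A_k divides (f A_k p) p0, with quotient f p0 p, but not p0; so it divides f A_k p, which puts f p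
   in U. *)
have [||] := upper_w_prime pat subR ind Us Up0 (k := k) (t := t).
- set p0 := \prod_(j <- s0) _ in Us0 *; set p := \prod_(j <- s) _.
  have -> : f * (w t (io k) * p) * p0 / w t (io k) = f * p0 * p.
    by have := w0 t (io k) => h; field.
  by apply: (subringM subU) => //; apply: Up.
- by rewrite mulrCA mulrAC mulfV // mul1r.
by move/(clusters_not_dvd (disj k)).
Qed.

End Final.

(** * Mutation of extended seeds *)

Section Tree.
Variable n : nat.

Definition nb_word (k : 'I_n) (s : seq 'I_n) : seq 'I_n :=
  if s is i :: s' then if i == k then s' else k :: s else [:: k].

Lemma nb_word_sorted k s : sorted (fun i j : 'I_n => i != j) s ->
  sorted (fun i j : 'I_n => i != j) (nb_word k s).
Proof.
case: s => //= i s pis; case: eqP => [_|/eqP ik] /=; first exact: path_sorted pis.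
by rewrite eq_sym ik.
Qed.

Definition tree_nb (k : 'I_n) (t : tree n) : tree n :=
  exist _ (nb_word k (sval t)) (nb_word_sorted k (svalP t)).

Lemma tree_eq (s t : tree n) : sval s = sval t -> s = t.
Proof. exact: val_inj. Qed.

Lemma tree_nbK k t : tree_nb k (tree_nb k t) = t.
Proof.
apply: tree_eq; case: t => [[|i s] /= pis]; rewrite ?eqxx //.
have [<-|ik] := eqVneq i k; last by rewrite /= eqxx.
by case: s pis => [|j s] //= /andP[ij _]; rewrite eq_sym (negPf ij).
Qed.

Lemma tree_nb_edge k t : tree_edge k t (tree_nb k t).
Proof.
rewrite /tree_edge; case: t => [[|i s] pis] /=; first by left.
by have [<-|ik] := eqVneq i k; [right | left].
Qed.

(** The tree is connected: every vertex is joined to the empty word, and P passes along edges both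
    ways since [tree_nb] is an involution. *)
Lemma tree_nb_ind (P : tree n -> Prop) t0 : P t0 ->
  (forall k t, P t -> P (tree_nb k t)) -> forall t, P t.
Proof.
move=> P0 Pnb; pose root : tree n := exist _ [::] isT.
have Pe k t : P (tree_nb k t) -> P t by move=> /(Pnb k); rewrite tree_nbK.
have Pr t : P t <-> P root.
  case: t => s; elim: s => [|k s IHs] ps; first by rewrite (@tree_eq (exist _ [::] ps) root).
  have ps' : sorted (fun i j : 'I_n => i != j) s by apply: path_sorted ps.
  have E : tree_nb k (exist _ (k :: s) ps) = exist _ s ps'.
    by apply: tree_eq; rewrite /= eqxx.
  rewrite -(IHs ps') -E; split; [exact: Pnb | exact: Pe].
by move=> t; apply/Pr; apply/(Pr t0).
Qed.

End Tree.

Lemma bezout_big (N : nat) (a : 'I_N -> int) :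
  exists l : 'I_N -> int, \sum_i l i * a i = \big[gcdz/0]_i a i.
Proof.
suff [l E] : exists l : 'I_N -> int, \sum_(i <- index_enum 'I_N) l i * a i
    = \big[gcdz/0]_(i <- index_enum 'I_N) a i by exists l.
elim: (index_enum _) (index_enum_uniq 'I_N) => [|i s IHs] /=.
  by exists (fun=> 0); rewrite !big_nil.
move=> /andP[nis /IHs[l E]]; rewrite big_cons -E.
have [x [y <-]] := Bezoutz (a i) (\sum_(j <- s) l j * a j).
exists (fun j => if j == i then x else y * l j).
rewrite big_cons eqxx; congr (_ + _); rewrite mulr_sumr big_seq [RHS]big_seq.
apply: eq_bigr => j js; rewrite ifF ?mulrA //.
by apply: contraNF nis => /eqP <-.
Qed.

Section Mutation.
Variables (K : idomainType) (m n : nat).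
Local Notation F := (rat_field K m n).
Local Notation io := (@lshift n m).

Definition ext_cluster (S : seed_data K m n) (i : 'I_(n + m)) : F :=
  match split i with inl j => exA S j | inr l => Zvar K n l end.

Definition ext_col (S : seed_data K m n) (k : 'I_n) : 'cV[int]_(n + m) :=
  col k (extended_matrix S).

Lemma ext_clusterA S j : ext_cluster S (io j) = exA S j.
Proof. by rewrite /ext_cluster (unsplitK (inl j)). Qed.

Lemma ext_clusterZ S l : ext_cluster S (rshift n l) = Zvar K n l.
Proof. by rewrite /ext_cluster (unsplitK (inr l)). Qed.

Lemma ext_colA S k j : ext_col S k (io j) 0 = exB S j k.
Proof. by rewrite mxE col_mxEu. Qed.

Lemma ext_colZ S k l : ext_col S k (rshift n l) 0 = (exX S k : 'cV[int]_m) l 0.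
Proof. by rewrite mxE col_mxEd mxE. Qed.

Lemma exchange_binomialE S k : exchange_binomial S k =
  mon (ext_cluster S) (posv (ext_col S k)) + mon (ext_cluster S) (posv (- ext_col S k)).
Proof.
have E (P : pred 'I_n) (b c : 'I_n -> int) (A : 'I_n -> F) :
    (forall j, c j = if P j then b j else 0) ->
    \prod_(j | P j) A j ^ b j = \prod_j A j ^ c j.
  by move=> cE; rewrite big_mkcond; apply: eq_bigr => j _; rewrite cE; case: ifP.
case: S => B X A; rewrite /mon !big_split_ord /=; congr (_ + _);
  rewrite mulrC; congr (_ * _).
- under [RHS]eq_bigr do rewrite ext_clusterA.
  by apply: E => j; rewrite mxE ext_colA /=; case: ltP; lia.
- apply: eq_bigr => l _; rewrite ext_clusterZ [posv _ _ _]mxE ext_colZ /= !mxE.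
  by congr (_ ^ _); move: (fun_of_matrix _ _ _) => x; case: leP; case: leP; lia.
- under [RHS]eq_bigr do rewrite ext_clusterA.
  by apply: E => j; rewrite [posv _ _ _]mxE [(- ext_col _ _) _ _]mxE ext_colA /=; case: ltP; lia.
apply: eq_bigr => l _; rewrite ext_clusterZ [posv _ _ _]mxE [(- ext_col _ _) _ _]mxE ext_colZ /= !mxE.
by congr (_ ^ _); move: (fun_of_matrix _ _ _) => x; case: leP; case: leP; lia.
Qed.

Lemma ext_cluster_out k S i : i != io k -> ext_cluster (mutation k S) i = ext_cluster S i.
Proof.
case: S => B X A; rewrite -[i]splitK; case: (split i) => [j|l] /= ik.
  rewrite !ext_clusterA /= ffunE ifF //.
  by apply: contraNF ik => /eqP ->.
by rewrite !ext_clusterZ.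
Qed.

Lemma ext_cluster_exch k S : exA S k != 0 ->
  ext_cluster S (io k) * ext_cluster (mutation k S) (io k) =
  mon (ext_cluster S) (posv (ext_col S k)) + mon (ext_cluster S) (posv (- ext_col S k)).
Proof.
rewrite -exchange_binomialE !ext_clusterA; case: S => B X A /= Ak.
by rewrite ffunE eqxx mulVKf.
Qed.

Lemma ext_col_same k S : ext_col (mutation k S) k = - ext_col S k.
Proof.
apply/matrixP=> i j; rewrite ord1 [RHS]mxE -[i]splitK; case: (split i) => l /=.
  by rewrite !ext_colA; case: S => B X A; rewrite /= mxE eqxx orbT.
by rewrite !ext_colZ; case: S => B X A; rewrite /= ffunE eqxx mxE.
Qed.

Lemma sg_max (x b : int) : Num.sg x * Num.max (x * b) 0 =
  Num.max x 0 * Num.max b 0 - Num.max (- x) 0 * Num.max (- b) 0.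
Proof.
case: (ltrgt0P x) => [x0|x0|->]; last by rewrite sgr0 oppr0 !mul0r subr0.
  rewrite gtr0_sg // mul1r [Num.max (- x) 0]max_r ?oppr_le0 ?ltW //.
  by rewrite mul0r subr0 maxr_pMr ?mulr0 ?ltW.
rewrite ltr0_sg // mul0r sub0r [Num.max (- x) 0]max_l ?oppr_ge0 ?ltW //.
by rewrite mulN1r maxr_pMr ?oppr_ge0 ?ltW // mulr0 mulrNN.
Qed.

(** One rule for exchange and coefficient rows. In row k the positive parts vanish, as b_kk = 0, and
    the last term reverses the sign of the entry; in other rows that term is 0. *)
Lemma ext_col_out k S j : exB S k k = 0 -> j != k -> ext_col (mutation k S) j =
  ext_col S j
    + posv (ext_col S k) *~ Num.max (ext_col S j (io k) 0) 0
    - posv (- ext_col S k) *~ Num.max (- ext_col S j (io k) 0) 0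
    - delta_mx (io k) 0 *~ (2 * ext_col S j (io k) 0).
Proof.
move=> Bkk jk; apply/matrixP=> i z; rewrite ord1.
have E (v : 'cV[int]_(n + m)) (a b c : int) : (v + posv (ext_col S k) *~ a
    - posv (- ext_col S k) *~ b - delta_mx (io k) 0 *~ c) i 0 = v i 0
    + Num.max (ext_col S k i 0) 0 * a - Num.max (- ext_col S k i 0) 0 * b
    - (i == io k)%:R * c.
  by rewrite !(mulrz_coef, mxE) andbT.
rewrite E -[i]splitK; case: (split i) => l /=.
  rewrite !ext_colA (inj_eq (@lshift_inj _ _)); case: S Bkk {E} => B X A /= Bkk.
  rewrite mxE (negPf jk) orbF; have [->|lk] := eqVneq l k.
    by rewrite Bkk oppr0 maxxx !mul0r; lia.
  by rewrite sg_max mul0r subr0 addrA.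
rewrite !ext_colZ ext_colA eq_rlshift mul0r subr0; case: S {Bkk E} => B X A /=.
rewrite ffunE (negPf jk) [LHS]mxE [X in X + _ = _]mxE !mulrz_coef !mxE.
move: (fun_of_matrix (X k) l 0) (B k j) => x b.
have -> : Num.min 0 x = - Num.max (- x) 0 by case: leP; case: leP; lia.
have {1}-> : x = Num.max x 0 - Num.max (- x) 0 by case: leP; case: leP; lia.
have {2}-> : b = Num.max b 0 - Num.max (- b) 0 by case: leP; case: leP; lia.
ring.
Qed.

Lemma skew_entry (B : 'M[int]_n) : skew_symmetrizable B ->
  exists2 d : 'rV[int]_n, forall i, 0 < d 0 i & forall i j, d 0 j * B j i = - (d 0 i * B i j).
Proof.
move=> [d d0 E]; exists d => // i j; have := congr1 (fun M : 'M_n => M i j) E.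
by rewrite !mul_diag_mx !mxE.
Qed.

Lemma skew_diag (B : 'M[int]_n) k : skew_symmetrizable B -> B k k = 0.
Proof.
move=> /skew_entry[d d0 /(_ k k) E]; apply: (mulfI (lt0r_neq0 (d0 k))).
by rewrite mulr0; lia.
Qed.

Lemma skew_sign (B : 'M[int]_n) i j : skew_symmetrizable B ->
  Num.sg (B i j) = - Num.sg (B j i).
Proof.
move=> /skew_entry[d d0 /(_ i j)/(congr1 Num.sg)].
by rewrite sgrN !sgrM (gtr0_sg (d0 i)) (gtr0_sg (d0 j)) !mul1r => ->; rewrite opprK.
Qed.

Lemma ext_col_posv_diag S k : exB S k k = 0 ->
  posv (ext_col S k) (io k) 0 = 0 /\ posv (- ext_col S k) (io k) 0 = 0.
Proof.
by move=> Bkk; split; rewrite [posv _ _ _]mxE ?[(- ext_col _ _) _ _]mxE ext_colA Bkk ?oppr0 maxxx.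
Qed.

(* When b = u_j(k), mutation acts on u_j as v |-> v + v(k) d with d(k) = -2,  *)
(* which preserves the values of integral linear forms up to a change of form. *)
Lemma mutation_prim S k j : exB S k k = 0 ->
  (exists l : 'rV[int]_(n + m), (l *m ext_col S j) 0 0 = 1) ->
  exists l : 'rV[int]_(n + m), (l *m ext_col (mutation k S) j) 0 0 = 1.
Proof.
move=> Bkk [l lu]; have [jk|jk] := eqVneq j k.
  by exists (- l); rewrite jk ext_col_same mulmxN mulNmx opprK -jk.
have [pk nk] := ext_col_posv_diag Bkk.
set b := ext_col S j (io k) 0.
pose d : 'cV[int]_(n + m) := (if 0 <= b then posv (ext_col S k)
  else posv (- ext_col S k)) - delta_mx (io k) 0 *~ 2.
have dk : d (io k) 0 = - 2.
  rewrite /d; case: ifP => _; rewrite mxE ?pk ?nk [X in _ + X]mxE mulrz_coef mxE !eqxx; lia.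
have uE : ext_col (mutation k S) j = ext_col S j + d *~ b.
  rewrite ext_col_out // -/b /d; apply/matrixP=> i z; rewrite ord1.
  case: (lerP 0 b) => b0.
    rewrite max_r ?oppr_le0 // mulr0z subr0.
    by rewrite mulrzBl addrA -mulrzA.
  rewrite max_l ?oppr_ge0 ?ltW // mulr0z addr0.
  by rewrite mulrzBl addrA mulrNz opprK -mulrzA.
(* On u + b d, the form l gains x b, while the added multiple of the k-th coordinate contributes x
   (b - 2 b). *)
pose x : int := (l *m d) 0 0; pose l' : 'rV[int]_(n + m) := l + x *: delta_mx 0 (io k).
have E v : (l' *m v) 0 0 = (l *m v) 0 0 + x * v (io k) 0.
  by rewrite mulmxDl -scalemxAl -rowE mxE [X in _ + X]mxE [row _ _ _ _]mxE.
exists l'; rewrite E uE mulmxDr [X in X + _]mxE lu [(ext_col S j + d *~ b) _ _]mxE mulrz_coef dk -/b.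
have -> : l *m (d *~ b) = (l *m d) *~ b.
  by rewrite -scaler_int -scalemxAr scaler_int.
by rewrite mulrz_coef -/x; ring.
Qed.

(** A relation c among the mutated columns reads v + v(k) d = 0, where v combines the old columns
    with coefficients c'. Its k-th entry is v(k) - 2 v(k), so v = 0; then c' = 0, and c = 0. *)
Lemma mutation_free S k : exB S k k = 0 ->
  (forall c : 'I_n -> int, \sum_j ext_col S j *~ c j = 0 -> forall j, c j = 0) ->
  forall c : 'I_n -> int, \sum_j ext_col (mutation k S) j *~ c j = 0 -> forall j, c j = 0.
Proof.
move=> Bkk free c c0.
have [pk nk] := ext_col_posv_diag Bkk.
pose b j := ext_col S j (io k) 0.
pose c' j := if j == k then \sum_(i | i != k) Num.max (b i) 0 * c i - c k else c j.
pose d : 'cV[int]_(n + m) := posv (- ext_col S k) - delta_mx (io k) 0 *~ 2.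
have dk : d (io k) 0 = - 2.
  by rewrite mxE nk [X in _ + X]mxE mulrz_coef mxE !eqxx; lia.
pose v := \sum_j ext_col S j *~ c' j.
have vE : v = \sum_(j | j != k) (ext_col S j + ext_col S k *~ Num.max (b j) 0) *~ c j
    - ext_col S k *~ c k.
  rewrite /v (bigD1 k) //= /c' eqxx mulrzBr mulrz_sumr addrAC -big_split /=.
  congr (_ - _); apply: eq_bigr => j /negPf ->.
  by rewrite mulrzDl mulrzA addrC.
have vk : v (io k) 0 = \sum_(j | j != k) b j * c j.
  rewrite vE mxE summxE [X in _ + X]mxE mulrz_coef ext_colA Bkk mul0r subr0.
  apply: eq_bigr => j _; rewrite mulrz_coef mxE mulrz_coef -/(b j).
  by rewrite [ext_col S k _ _]ext_colA Bkk mul0r addr0.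
have uE j : j != k -> ext_col (mutation k S) j =
    ext_col S j + ext_col S k *~ Num.max (b j) 0 + d *~ b j.
  move=> jk; rewrite ext_col_out // -/(b j) /d; move: (posvB (ext_col S k)).
  move: (posv (ext_col S k)) (posv (- ext_col S k)) (delta_mx _ _) => p q e <-.
  rewrite !mulrzBl -mulrzA -!addrA; congr (_ + (_ + _)).
  rewrite addrA; congr (_ - _).
  have {3}-> : b j = Num.max (b j) 0 - Num.max (- b j) 0 by case: leP; case: leP; lia.
  by rewrite mulrzBr addrA addNr add0r.
have E : v + d *~ v (io k) 0 = 0.
  rewrite -[RHS]c0 (bigD1 k) //= ext_col_same vk vE addrAC mulNrz [RHS]addrC.
  congr (_ - _); rewrite mulrz_sumr -big_split /=; apply: eq_bigr => j jk.
  by rewrite uE // [RHS]mulrzDl mulrzA.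
have v0 : v = 0.
  have h : v (io k) 0 = 0.
    have := congr1 (fun a : 'cV[int]_(n + m) => a (io k) 0) E.
    by rewrite mxE mulrz_coef dk [RHS]mxE; move: (v _ _) => x; lia.
  by move: E; rewrite h mulr0z addr0.
have c'0 := free c' v0.
have cj j : j != k -> c j = 0 by move=> jk; have := c'0 j; rewrite /c' (negPf jk).
move=> j; have [->|/cj //] := eqVneq j k.
have := c'0 k; rewrite /c' eqxx big1 => [|i /cj ->]; last by rewrite mulr0.
by rewrite sub0r => /eqP; rewrite oppr_eq0 => /eqP.
Qed.

End Mutation.

(** * Independence of extended clusters *)

Section LaurentSpan.
Variables (F : fieldType) (p : nat) (x : 'I_p -> F) (R : F -> Prop).
Hypotheses (subR : subring R) (x0 : forall i, x i != 0).

Definition monr (e : 'rV[int]_p) : F := \prod_(i < p) x i ^ e 0 i.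

Lemma monr_0 : monr 0 = 1.
Proof. by apply: big1 => i _; rewrite mxE expr0z. Qed.

Lemma monr_D a b : monr (a + b) = monr a * monr b.
Proof. by rewrite -big_split; apply: eq_bigr => i _; rewrite mxE expfzDr. Qed.

Lemma monr_delta i : monr (delta_mx 0 i) = x i.
Proof.
rewrite /monr (bigD1 i) //= mxE !eqxx big1 ?mulr1 // => j ji.
by rewrite mxE (negPf ji) andbF.
Qed.

Lemma laurent_span f : laurent R x f <-> span monr R (fun=> True) f.
Proof.
split=> [[s [c [Rc ->]]]|/(span_rep subR)[s [c [_ Rc _ _ ->]]]]; last by exists s, c.
elim: s => [|e s IHs]; first by rewrite big_nil; apply: span0.
by rewrite big_cons; apply: span_add.
Qed.

Lemma laurent_subring : subring (laurent R x).
Proof.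
have subL : subring (span monr R (fun=> True)) by apply: span_subring monr_D _ _ => //; exact: monr_0.
split=> [|a b|a b]; rewrite !laurent_span.
- exact: subring1.
- exact: subringB.
exact: subringM.
Qed.

Lemma laurent_scal c : R c -> laurent R x c.
Proof. by move=> Rc; apply/laurent_span; apply: span_scal => //; apply: monr_0. Qed.

Lemma laurent_var i : laurent R x (x i) /\ laurent R x (x i)^-1.
Proof.
split; apply/laurent_span; rewrite -monr_delta; first exact: span_mon.
by rewrite -(monN monr_0 monr_D); apply: span_mon.
Qed.

End LaurentSpan.

Lemma sum_pick (R : pzRingType) (T : eqType) (s : seq T) (f : T -> R) (b : T -> bool) e0 :
  uniq s -> e0 \in s -> b e0 -> (forall e, e \in s -> e != e0 -> b e = false) ->
  \sum_(e <- s) f e * (b e)%:R = f e0.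
Proof.
move=> us e0s b0 bN; rewrite (bigD1_seq e0) //= b0 mulr1 big_seq_cond big1 ?addr0 //.
by move=> e /andP[es ne]; rewrite bN // mulr0.
Qed.

Section Field.
Variables (K : idomainType) (m n : nat).
Local Notation F := (rat_field K m n).
Local Notation io := (@lshift n m).

Definition iota_mp : {rmorphism {mpoly K[m]} -> F} :=
  [the {rmorphism {mpoly K[m]} -> F} of
    (@tofrac {mpoly (coef_field K m)[n]}) \o (@mpolyC n (coef_field K m))
      \o (@tofrac {mpoly K[m]})].

Lemma Zvar_iota (l : 'I_m) : Zvar K n l = iota_mp 'X_l. Proof. by []. Qed.
Lemma Kinj_iota (a : K) : Kinj m n a = iota_mp a%:MP_[m]. Proof. by []. Qed.

Lemma iota_mp_eq0 p : iota_mp p = 0 -> p = 0.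
Proof.
move=> /eqP.
change (tofrac (@mpolyC n (coef_field K m) (tofrac p)) == 0 :> F -> p = 0).
rewrite tofrac_eq0 => h.
have := h; rewrite mpolyC_eq0 tofrac_eq0 => /eqP //.
Qed.

Definition Kscal (f : F) := exists a : K, f = Kinj m n a.

Lemma Kscal_subring : subring Kscal.
Proof.
split=> [|_ _ [a ->] [b ->]|_ _ [a ->] [b ->]].
- by exists 1; rewrite Kinj_iota rmorph1.
- by exists (a - b); rewrite !Kinj_iota !rmorphB.
by exists (a * b); rewrite !Kinj_iota !rmorphM.
Qed.

Lemma Zvar_neq0 (l : 'I_m) : Zvar K n l != 0.
Proof.
apply/eqP; rewrite Zvar_iota => /iota_mp_eq0/(congr1 (mcoeff U_(l))) /eqP.
by rewrite mcoeffXU eqxx mcoeff0 oner_eq0.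
Qed.

Lemma KP_subring : subring (@KP K m n).
Proof. exact: laurent_subring Kscal_subring Zvar_neq0. Qed.

Lemma natr_F_inj (charK : [pchar K] =i pred0) (i : nat) : i%:R = 0 :> F -> i = 0%N.
Proof.
rewrite -(rmorph_nat iota_mp) => /iota_mp_eq0 /eqP.
rewrite -(rmorph_nat (@mpolyC m K)) mpolyC_eq0 => h.
by apply/eqP; rewrite -(pcharf0P K).1.
Qed.

Lemma cluster_neq0 (A : 'I_n -> F) i : free_generating A -> A i != 0.
Proof.
move=> [free _]; apply/eqP => Ai0.
have /(congr1 (mcoeff U_(i))) /eqP : 'X_i = 0 :> {mpoly F[n]}.
  apply: free; last by rewrite mevalXU.
  by move=> e; rewrite mcoeffX; apply: (subringMn KP_subring); apply: (subring1 KP_subring).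
by rewrite mcoeffXU eqxx mcoeff0 oner_eq0.
Qed.

Lemma Kscal_KP f : Kscal f -> KP f.
Proof. exact: (@laurent_scal _ _ _ _ Kscal_subring f). Qed.

Lemma iota_mpX (nu : 'X_{1..m}) :
  iota_mp 'X_[nu] = \prod_l Zvar K n l ^+ nu l.
Proof.
by rewrite mpolyXE_id rmorph_prod; apply: eq_bigr => l _; rewrite rmorphXn.
Qed.

Lemma KP_iotaX (nu : 'X_{1..m}) : KP (iota_mp 'X_[nu]).
Proof.
rewrite iota_mpX; apply: (subring_prod KP_subring) => l _.
apply: (subringX KP_subring).
by case: (laurent_var Kscal_subring (@Zvar_neq0) l).
Qed.

(** Times a high power of all variables, a relation becomes polynomial. Freeness over KP kills the
    coefficient of each cluster monomial; this is a polynomial in Z, whose coefficients in K vanish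
    in turn. *)
Lemma ext_cluster_indep (S : seed_data K m n) : free_generating (exA S) ->
  indep (mon (ext_cluster S)) Kscal.
Proof.
move=> fg s c us Kc E e0 e0s.
have ex e : exists a : K, Kinj m n a == c e.
  by have [a ->] := Kc e; exists a.
pose a e := xchoose (ex e).
have aE e : c e = Kinj m n (a e) by apply/esym/eqP; apply: (xchooseP (ex e)).
(* [N] bounds every exponent in absolute value, so adding it makes them natural numbers. *)
pose N := (\sum_(e <- s) \sum_i absz (e i 0%R))%N.
have leN e i : e \in s -> (absz (e i 0%R) <= N)%N.
  move=> es; rewrite /N (bigD1_seq e) //= (bigD1 i) //=; lia.
pose nexp (e : 'cV[int]_(n + m)) i := absz (e i 0 + N%:Z).
have nexpE e i : e \in s -> (nexp e i)%:Z = e i 0 + N%:Z.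
  move=> es; have := leN e i es; rewrite /nexp.
  by move: (e i 0) (N) => x y; case: x => x; lia.
pose muA e := [multinom nexp e (io j) | j < n].
pose muZ e := [multinom nexp e (rshift n l) | l < m].
have mon_nat e : e \in s -> mon (ext_cluster S) e * \prod_i ext_cluster S i ^+ N
    = iota_mp 'X_[muZ e] * \prod_j exA S j ^+ muA e j.
  move=> es; rewrite iota_mpX -big_split /=.
  transitivity (\prod_i ext_cluster S i ^+ nexp e i).
    apply: eq_bigr => i _; rewrite [RHS]exprnP nexpE // expfzDr //.
    rewrite -[i]splitK; case: (split i) => l /=.
      by rewrite ext_clusterA; apply: cluster_neq0.
    by rewrite ext_clusterZ Zvar_neq0.
  rewrite big_split_ord /= mulrC; congr (_ * _); apply: eq_bigr => l _.
    by rewrite ext_clusterZ mnmE.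
  by rewrite ext_clusterA mnmE.
pose P := \sum_(e <- s) (c e * iota_mp 'X_[muZ e]) *: 'X_[muA e].
have Pcoef mu : P@_mu = \sum_(e <- s) c e * iota_mp 'X_[muZ e] * (muA e == mu)%:R.
  by rewrite raddf_sum; apply: eq_bigr => e _; rewrite /= mcoeffZ mcoeffX.
have P0 : P = 0.
  apply: (proj1 fg) => [mu|].
    rewrite Pcoef; apply: (subring_sum KP_subring) => e _.
    apply: (subringM KP_subring); last by apply: (subringMn KP_subring); apply: (subring1 KP_subring).
    by apply: (subringM KP_subring); [apply: Kscal_KP | apply: KP_iotaX].
  have evalP (d : 'cV[int]_(n + m) -> F) : (\sum_(e <- s) d e *: 'X_[muA e]).@[exA S]
      = \sum_(e <- s) d e * \prod_j exA S j ^+ muA e j.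
    by rewrite raddf_sum /=; apply: eq_bigr => e _; rewrite mevalZ mevalX.
  rewrite (evalP (fun e => c e * iota_mp 'X_[muZ e]))
    -[RHS](mul0r (\prod_i ext_cluster S i ^+ N)) -[in RHS]E mulr_suml.
  rewrite [LHS]big_seq [RHS]big_seq; apply: eq_bigr => e es.
  by rewrite -mulrA -mon_nat // mulrA.
(* The coefficient of P at the cluster monomial of e0, taken in K[Z] instead of the field. *)
pose Q := \sum_(e <- s) (a e * (muA e == muA e0)%:R) *: 'X_[muZ e].
have Q0 : Q = 0.
  apply: (@iota_mp_eq0 Q); rewrite [LHS]raddf_sum -[RHS](mcoeff0 _ (muA e0)) -P0 Pcoef.
  apply: eq_bigr => e _; rewrite aE Kinj_iota -mul_mpolyC.
  rewrite (rmorphM (@mpolyC m K)) [X in iota_mp X = _]mulrAC.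
  rewrite [LHS]rmorphM; congr (_ * _); first by rewrite rmorphM.
  by rewrite -[RHS](rmorph_nat iota_mp) -[in RHS](rmorph_nat (@mpolyC m K)).
suff ae0 : a e0 = 0 by rewrite aE ae0 Kinj_iota mpolyC0 rmorph0.
pose b e := (muA e == muA e0) && (muZ e == muZ e0).
have QE : \sum_(e <- s) a e * (b e)%:R = 0.
  rewrite -[RHS](mcoeff0 _ (muZ e0)) -Q0 [RHS]raddf_sum; apply: eq_bigr => e _.
  by rewrite /b -mulnb natrM mulrA [RHS]mcoeffZ mcoeffX.
rewrite -QE; apply/esym; apply: sum_pick => // [|e es ne]; first by rewrite /b !eqxx.
apply: contraNF ne => /andP[/eqP EA /eqP EZ].
apply/eqP/matrixP => i z; rewrite ord1; apply: (addIr N%:Z).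
rewrite -!nexpE //; congr Posz; rewrite -[i]splitK; case: (split i) => l /=.
  by have := congr1 (fun mu : 'X_{1..n} => mu l) EA; rewrite !mnmE.
by have := congr1 (fun mu : 'X_{1..m} => mu l) EZ; rewrite !mnmE.
Qed.

End Field.

(** * Seed patterns *)

Section Seeds.
Variables (K : idomainType) (m n : nat).
Local Notation F := (rat_field K m n).
Local Notation io := (@lshift n m).

(** KP is itself a Laurent ring over K, so L(t) is the K-span of the monomials in the extended
    cluster; both inclusions are checked on generators. *)
Lemma laurent_ring_span (S : seed_data K m n) f : free_generating (exA S) ->
  laurent_ring S f <-> span (mon (ext_cluster S)) (@Kscal K m n) (@all_exp n m) f.
Proof.
move=> fg; set w := ext_cluster S.
have A0 j : exA S j != 0 by apply: cluster_neq0.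
have w0 i : w i != 0.
  rewrite /w -[i]splitK; case: (split i) => l /=; first by rewrite ext_clusterA.
  by rewrite ext_clusterZ Zvar_neq0.
have subK := @Kscal_subring K m n; have subKP := @KP_subring K m n.
have subL : subring (span (mon w) (@Kscal K m n) (@all_exp n m)).
  exact: (span_subring subK (mon_0 w) (mon_D w0)).
have subA := laurent_subring subKP A0.
have Lw i : span (mon w) (@Kscal K m n) (@all_exp n m) (w i) /\
    span (mon w) (@Kscal K m n) (@all_exp n m) (w i)^-1.
  rewrite -mon_delta -(monN (mon_0 w) (mon_D w0)).
  by split; apply: span_mon.
split.
  rewrite /laurent_ring (laurent_span _ subKP); apply: (span_min subL) => [c|e _].
    rewrite /KP (laurent_span _ subK); apply: (span_min subL) => [a Ka|e _].
      by apply: (span_scal (mon_0 w)).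
    apply: (subring_prod subL) => l _; apply: (subring_exprz subL);
      rewrite -(ext_clusterZ S l); by case: (Lw (rshift n l)).
  apply: (subring_prod subL) => j _; apply: (subring_exprz subL);
    rewrite -(ext_clusterA S j); by case: (Lw (io j)).
apply: (span_min subA) => [c /Kscal_KP|e _]; first exact: laurent_scal.
apply: (subring_prod subA) => i _.
have [Ai AiV] : laurent_ring S (w i) /\ laurent_ring S (w i)^-1.
  rewrite /w -[i]splitK; case: (split i) => l /=.
    by rewrite ext_clusterA; apply: (laurent_var subKP A0).
  have [Zl ZlV] := laurent_var subK (@Zvar_neq0 K m n) l.
  by rewrite ext_clusterZ; split; apply: laurent_scal.
exact: (subring_exprz subA).
Qed.

Lemma rank_free (S : seed_data K m n) :
  \rank (map_mx (fun z : int => z%:~R : rat) (extended_matrix S)) = n ->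
  forall c : 'I_n -> int, \sum_j ext_col S j *~ c j = 0 -> forall j, c j = 0.
Proof.
set M := map_mx _ _ => rkM c c0.
have /row_fullP[B BM] : row_full M by rewrite /row_full rkM.
pose v : 'cV[rat]_n := \col_j (c j)%:~R.
have Mv : M *m v = 0.
  apply/matrixP=> i z; rewrite ord1 mxE [RHS]mxE.
  have := congr1 (fun a : 'cV[int]_(n + m) => (a i 0)%:~R : rat) c0.
  rewrite summxE rmorph_sum mxE => h; rewrite -[RHS]h; apply: eq_bigr => j _.
  by rewrite mulrz_coef !mxE rmorphM.
have v0 : v = 0 by rewrite -[v]mul1mx -BM -mulmxA Mv mulmx0.
move=> j; have := congr1 (fun a : 'cV[rat]_n => a j 0) v0.
by rewrite !mxE => /eqP; rewrite intr_eq0 => /eqP.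
Qed.

Lemma free_nonmult (S : seed_data K m n) j k z :
  (forall c : 'I_n -> int, \sum_j ext_col S j *~ c j = 0 -> forall j, c j = 0) ->
  j != k -> ext_col S k <> ext_col S j *~ z.
Proof.
move=> free jk E.
pose c i : int := if i == k then 1 else if i == j then - z else 0.
have := free c _ k; rewrite /c eqxx => h.
suff : 1 = 0 :> int by [].
apply: h; rewrite (bigD1 k) //= eqxx (bigD1 j) //= (negPf jk) eqxx.
rewrite big1 => [|i /andP[/negPf -> /negPf ->]]; last by rewrite mulr0z.
by rewrite addr0 mulrNz E mulr1z subrr.
Qed.

Variable S : tree n -> seed_data K m n.
Hypotheses (patS : seed_pattern S) (rankS : full_rank S) (primS : primitive S).

Lemma seed_nb k t : S (tree_nb k t) = mutation k (S t).
Proof. by apply: (proj2 patS); apply: tree_nb_edge. Qed.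

(** Rank and primitivity are given at one seed each; they travel along the tree as independence of
    the columns over Z and as integral forms with value 1. *)
Lemma seed_pattern_pattern : pattern (@tree_nb n)
  (fun t => ext_cluster (S t)) (fun t => ext_col (S t)).
Proof.
have seedS t : is_seed (S t) := proj1 patS t.
have A0 t j : exA (S t) j != 0 by apply: cluster_neq0; case: (seedS t).
have diag t k : exB (S t) k k = 0 by apply: skew_diag; case: (seedS t).
have free t : forall c : 'I_n -> int, \sum_j ext_col (S t) j *~ c j = 0 -> forall j, c j = 0.
  have [t1 /rank_free free1] := rankS.
  apply: (tree_nb_ind (t0 := t1) (P := fun t => forall c : 'I_n -> int,
    \sum_j ext_col (S t) j *~ c j = 0 -> forall j, c j = 0)) => // k t' ft'.
  by rewrite seed_nb; apply: mutation_free.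
split.
- exact: tree_nbK.
- exact: tree_nb_ind.
- move=> t i; rewrite -[i]splitK; case: (split i) => l /=.
    by rewrite ext_clusterA.
  by rewrite ext_clusterZ Zvar_neq0.
- by move=> k t i ik; rewrite seed_nb ext_cluster_out.
- by move=> k t; rewrite seed_nb; apply: ext_cluster_exch.
- by move=> k t; rewrite seed_nb; apply: ext_col_same.
- by move=> k t j jk; rewrite seed_nb; apply: ext_col_out.
- by move=> t k; rewrite ext_colA.
- by move=> t j k; rewrite !ext_colA; apply: skew_sign; case: (seedS t).
- move=> t k; have [t1 prim1] := primS.
  apply: (tree_nb_ind (t0 := t1) (P := fun t =>
    exists l : 'rV[int]_(n + m), (l *m ext_col (S t) k) 0 0 = 1)) => [|i t' IH].
    have [l lE] := bezout_big (fun i => extended_matrix (S t1) i k).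
    exists (\row_i l i); rewrite mxE -[RHS](prim1 k) -lE.
    by apply: eq_bigr => i _; rewrite !mxE.
  by rewrite seed_nb; apply: mutation_prim.
by move=> t j k z jk; apply: free_nonmult jk; apply: free.
Qed.

End Seeds.

Theorem theorem4p23 (K : idomainType) (ufdK : factorial_domain K)
    (charK : [pchar K] =i pred0) (m n : nat) (S : tree n -> seed_data K m n)
    (patS : seed_pattern S) (binS : no_invertible_binomial S)
    (rankS : full_rank S) (primS : primitive S)
    (t t0 : tree n) (disj : no_common_cluster_variables (S t) (S t0)) :
  forall f : rat_field K m n,
    upper_cluster_algebra S f <->
    laurent_ring (S t) f /\ laurent_ring (S t0) f.
Proof.
move=> f; split=> [Uf|[ft ft0] t']; first by split; apply: Uf.
have fg s : free_generating (exA (S s)) := proj2 (proj1 patS s).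
have pat := seed_pattern_pattern patS rankS primS.
apply/(laurent_ring_span _ (fg t')).
apply: (upper_two_clusters pat (@Kscal_subring K m n)
  (fun s => ext_cluster_indep (fg s)) (@natr_F_inj K m n charK) (t := t) (t0 := t0)).
- by move=> i j; rewrite !ext_clusterA.
- exact/(laurent_ring_span _ (fg t)).
exact/(laurent_ring_span _ (fg t0)).
Qed.
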